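(* Let $\Omega=(\mathcal{C},\mathcal{D};\Gamma,\Delta)$ be a cross-connection of consistent categories. Let $\mathcal{I}(\Omega)$ be the category whose object set is $E_\Omega=\{(c,d)\in v\mathcal{C}\times v\mathcal{D}: c\in M\Gamma(d)\}$ (the regular biordered set of idempotents of the cross-connection semigroup $\mathbb{S}\Omega$, with $(c,d)$ identified with $(\gamma(c,d),\delta(c,d))$), and whose morphisms from $(c,d)$ to $(c',d')$ are the bimorphisms $u\colon c\to c'$ of $\mathcal{C}$, composed as in $\mathcal{C}$. For morphisms $u_1\colon(c_1,d_1)\to(c_1',d_1')$ and $u_2\colon(c_2,d_2)\to(c_2',d_2')$, with connecting isomorphisms $\upsilon_1$ and $\upsilon_2$ respectively, put $$u_1\leq_\Omega u_2\iff (c_1,d_1)\subseteq(c_2,d_2),\quad u_1=(j_{c_1}^{c_2}u_2)^\circ\ \text{ and }\ (c_1',d_1')=(c_1,d_1)\upsilon_2 .$$ For a morphism $u\colon(c,d)\to(c',d')$ with connecting isomorphism $\upsilon$: the restriction of $u$ to $(c_1,d_1)\subseteq(c,d)$ is $(j_{c_1}^cu)^\circ$, and the corestriction of $u$ to $(c_1',d_1')\subseteq(c',d')$ is $(j_{c_1}^cu)^\circ$, where $(c_1,d_1)=(c_1',d_1')\upsilon^{-1}$. For $(c,d)\mathrel{\mathscr{R}}(c',d')$ or $(c,d)\mathrel{\mathscr{L}}(c',d')$ let the distinguished morphism from $(c,d)$ to $(c',d')$ be the isomorphism $\gamma(c',d')(c)$. Then $(\mathcal{I}(\Omega),\leq_\Omega)$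 is an inductive cancellative category.
   Context: Functions, morphisms and natural transformations are composed from left to right. **Categories with subobjects.** A pair $(\mathcal{C},\mathcal{P})$, with $\mathcal{C}$ a small category and $\mathcal{P}$ a subcategory, such that: $\mathcal{P}$ is a strict preorder (at most one morphism between any two objects; identities are the only isomorphisms) with $v\mathcal{P}=v\mathcal{C}$ ($v$ denotes the object set); every $f\in\mathcal{P}$ is a monomorphism in $\mathcal{C}$; if $f,g\in\mathcal{P}$ and $f=hg$ with $h\in\mathcal{C}$, then $h\in\mathcal{P}$. Morphisms of $\mathcal{P}$ are inclusions; write $c'\subseteq c$ ($c'$ is a subobject of $c$) and $j_{c'}^{c}$ for the inclusion $c'\to c$. An inclusion $j_{c'}^c$ splits if there is $q\colon c\to c'$ with $j_{c'}^cq=1_{c'}$; such $q$ is a retraction. A bimorphism is a morphism that is both left and right cancellable. A consistent (resp. normal) factorisation of $f$ is $f=quj$ with $q$ a retraction, $u$ a bimorphism (resp. isomorphism), $j$ an inclusion; then $f^\circ=qu$ (which is unique) is the epimorphic component of $f$, and its codomain is $\mathrm{im} f$. For $c\in v\mathcal{C}$, the ideal $(c)$ is the full subcategory of $\mathcal{C}$ on the subobjects of $c$; $\sigma(c)$ is the preorder of subobjects of $c$ with inclusions as morphisms; $cor\,\mathcal{C}$ is the subcategory of $\mathcal{C}$ generated by inclusions and retractions, and $\langle c\rangle$ is the full subcategory of $cor\,\mathcal{C}$ generated by the inclusions and retractions among the subobjects of $c$. A bimorphism $u\colon c\to d$ is consistent if the functor $T^u\colon\sigma(c)\to\sigma(d)$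 defined by $T^u(c')=\mathrm{im}(j_{c'}^cu)$ and $T^u(j_{c'}^{c''})=j_{T^u(c')}^{T^u(c'')}$ for each $c'\subseteq c''\subseteq c$ can be extended uniquely to an isomorphism $T\colon\langle c\rangle\to\langle d\rangle$ such that the map given by $c'\mapsto T(c')$ is a natural isomorphism between the functors $J(\langle c\rangle,\mathcal{C})$ and $T\colon\langle c\rangle\to\mathcal{C}$, where $J(\langle c\rangle,\mathcal{C})$ is the inclusion functor of $\langle c\rangle$ in $\mathcal{C}$. A consistent cone $\gamma$ with apex $c_\gamma$ is a map $\gamma\colon v\mathcal{C}\to\mathcal{C}$, $\gamma(a)\in\mathcal{C}(a,c_\gamma)$, with $j_a^b\gamma(b)=\gamma(a)$ whenever $a\subseteq b$ and with at least one $\gamma(c)$ a bimorphism. **Consistent category.** A category $\mathcal{C}$ with subobjects such that: every inclusion splits; every morphism has a consistent factorisation; every bimorphism is consistent; every morphism of the form $jq$ with $j$ an inclusion and $q$ a retraction has a normal factorisation; for each $c\in v\mathcal{C}$ there is a consistent cone $\epsilon$ with $\epsilon(c)=1_c$. **Cones and dual.** For a consistent cone $\gamma$ and an epimorphism $f\colon c_\gamma\to d$, $\gamma\ast f$ is the cone $c\mapsto\gamma(c)f$ with apex $d$. Consistent cones form a semigroup under $\gamma^{(1)}\cdot\gamma^{(2)}=\gamma^{(1)}\ast(\gamma^{(2)}(c_{\gamma^{(1)}}))^\circ$; $\epsilon$ is an idempotent cone iff $\epsilon(c_\epsilon)=1_{c_\epsilon}$. For an idempotent cone $\epsilon$, $H(\epsilon;-)\colon\mathcal{C}\to\mathbf{Set}$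 is given by $H(\epsilon;c)=\{\epsilon\ast f^\circ: f\in\mathcal{C}(c_\epsilon,c)\}$, $H(\epsilon;g)\colon\epsilon\ast f^\circ\mapsto\epsilon\ast(fg)^\circ$; $\eta_\epsilon\colon H(\epsilon;-)\to\mathcal{C}(c_\epsilon,-)$, $\epsilon\ast f^\circ\mapsto f$, is a natural isomorphism. The consistent dual $\mathcal{C}^*$ is the full subcategory of $[\mathcal{C},\mathbf{Set}]$ on the functors $H(\epsilon;-)$, $\epsilon$ an idempotent cone; its inclusions are the inclusions of subfunctors. $MH(\epsilon;-)=\{c\in v\mathcal{C}:\epsilon(c)\text{ is an isomorphism}\}$. **Cross-connection.** A functor $F\colon\mathcal{C}\to\mathcal{D}$ between consistent categories is a local isomorphism if it is inclusion preserving, fully faithful, and for each $c\in v\mathcal{C}$ restricts to an isomorphism of the ideal $(c)$ onto $(F(c))$. A cross-connection $\Omega=(\mathcal{C},\mathcal{D};\Gamma,\Delta)$ consists of local isomorphisms $\Gamma\colon\mathcal{D}\to\mathcal{C}^*$, $\Delta\colon\mathcal{C}\to\mathcal{D}^*$ such that $c\in M\Gamma(d)\iff d\in M\Delta(c)$ for all $c\in v\mathcal{C}$, $d\in v\mathcal{D}$. For $(c,d)\in E_\Omega$, $\gamma(c,d)$ is the unique idempotent cone in $\mathcal{C}$ with apex $c$ and $H(\gamma(c,d);-)=\Gamma(d)$, and $\delta(c,d)$ is the unique idempotent cone in $\mathcal{D}$ with apex $d$ and $H(\delta(c,d);-)=\Delta(c)$. For $f\in\mathcal{C}(c',c)$,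 $d\in M\Delta(c')$, $d'\in M\Delta(c)$, the transpose $f^\ddagger\in\mathcal{D}(d',d)$ is the unique morphism with $\mathcal{D}(f^\ddagger,-)=\eta_{\delta(c',d)}^{-1}\,\Delta(f)\,\eta_{\delta(c,d')}$. **Cross-connection semigroup.** Put $\Gamma(c,d)=\Gamma(d)(c)=\{\gamma(c',d)\ast f^\circ: c'\in M\Gamma(d), f\in\mathcal{C}(c',c)\}$, $\Delta(c,d)=\Delta(c)(d)=\{\delta(c,d')\ast g^\circ: d'\in M\Delta(c), g\in\mathcal{D}(d',d)\}$, and let $\chi(c,d)\colon\Gamma(c,d)\to\Delta(c,d)$ be the bijection $\gamma(c',d)\ast f^\circ\mapsto\delta(c,d')\ast(f^\ddagger)^\circ$, $f^\ddagger\in\mathcal{D}(d',d)$. A pair $(\gamma,\delta)$ is linked if for some $(c,d)\in v\mathcal{C}\times v\mathcal{D}$, $\gamma\in\Gamma(c,d)$ and $\delta=\chi(c,d)(\gamma)$. $\mathbb{S}\Omega$ is the semigroup of linked pairs with $(\gamma,\delta)\circ(\gamma',\delta')=(\gamma\cdot\gamma',\delta'\cdot\delta)$. Its idempotents are the pairs $(\gamma(c,d),\delta(c,d))$, $(c,d)\in E_\Omega$; the biorder relations are $(c,d)\mathrel{\omega^l}(c',d')\iff c\subseteq c'$, $(c,d)\mathrel{\omega^r}(c',d')\iff d\subseteq d'$; $(c,d)\subseteq(c',d')$ means $c\subseteq c'$ and $d\subseteq d'$. The connecting isomorphism of a morphism $u\colon(c,d)\to(c',d')$ is that of the element $x_u=(\gamma(c,d)\ast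 u,\ \delta(c',d')\ast u^\ddagger)\in\mathbb{S}\Omega$, $u^\ddagger\in\mathcal{D}(d',d)$: the isomorphism $\upsilon\colon\langle(c,d)\rangle\to\langle(c',d')\rangle$ with $y\,x_u=x_u\,(y\upsilon)$ for all $y\in\langle(c,d)\rangle$, where for an idempotent $e$, $\langle e\rangle$ is the subsemigroup generated by $\omega(e)=\{g: g \text{ idempotent}, ge=eg=g\}$; it restricts to a bijection $\omega((c,d))\to\omega((c',d'))$. **Ordered cancellative category.** A small category $\mathcal{I}$ with a partial order $\leq$ on it ($\mathbf d,\mathbf r$ = domain, codomain) such that: (OCC1) every morphism is a bimorphism; (OCC2) if $u\leq x$, $v\leq y$, $\mathbf r(u)=\mathbf d(v)$, $\mathbf r(x)=\mathbf d(y)$, then $uv\leq xy$; (OCC3) if $x\leq y$ then $1_{\mathbf d(x)}\leq1_{\mathbf d(y)}$ and $1_{\mathbf r(x)}\leq1_{\mathbf r(y)}$; (OCC4) if $1_e\leq1_{\mathbf d(x)}$ there is a unique $e{\downharpoonleft}x\leq x$ (restriction) with $\mathbf d(e{\downharpoonleft}x)=e$; (OCC5) if $1_f\leq1_{\mathbf r(x)}$ there is a unique $x{\downharpoonright}f\leq x$ (corestriction) with $\mathbf r(x{\downharpoonright}f)=f$. **Inductive cancellative category.** In a regular biordered set $E$ (the idempotents of a semigroup in which they generate a regular subsemigroup), $e\mathrel{\omega^l}f\iff ef=e$, $e\mathrel{\omega^r}f\iff fe=e$, $\omega=\omega^l\cap\omega^r$, $\mathscr{L}=\omega^l\cap(\omega^l)^{-1}$,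 $\mathscr{R}=\omega^r\cap(\omega^r)^{-1}$; a singular $E$-square is a square $\bigl[\begin{smallmatrix} e & f \\ g & h \end{smallmatrix}\bigr]$ of the form $\bigl[\begin{smallmatrix} g & h \\ kg & kh \end{smallmatrix}\bigr]$ with $g,h\mathrel{\omega^l}k$, $g\mathrel{\mathscr{R}}h$, or of the form $\bigl[\begin{smallmatrix} g & gk \\ h & hk \end{smallmatrix}\bigr]$ with $g,h\mathrel{\omega^r}k$, $g\mathrel{\mathscr{L}}h$. An ordered cancellative category $(\mathcal{I},\leq)$ with $v\mathcal{I}=E$ a regular biordered set such that $\omega$ coincides with $\leq$ on $E$, equipped with a distinguished morphism $[e,f]\colon e\to f$ whenever $e\mathrel{\mathscr{R}}f$ or $e\mathrel{\mathscr{L}}f$, such that (i) $[e,e]=1_e$; (ii) $[e,f][f,g]=[e,g]$ if $e\mathrel{\mathscr{R}}f\mathrel{\mathscr{R}}g$ or $e\mathrel{\mathscr{L}}f\mathrel{\mathscr{L}}g$; (iii) if $[g,h]$ exists and $e\mathrel{\omega}g$ then $[e,f]$ exists with $f=heh$ and $[e,f]\leq[g,h]$; is an inductive cancellative category if the following and their duals hold: (ICC1) for $x\in\mathcal{I}$ and $e_1,e_2\leq\mathbf d(x)$, $f_i=\mathbf r(e_i{\downharpoonleft}x)$: if $e_1\mathrel{\omega^r}e_2$ then $f_1\mathrel{\omega^r}f_2$ and $[e_1,e_1e_2](e_1e_2{\downharpoonleft}x)=(e_1{\downharpoonleft}x)[f_1,f_1f_2]$; (ICC2) if $\bigl[\begin{smallmatrix}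 e & f \\ g & h \end{smallmatrix}\bigr]$ is a singular $E$-square then $[e,f][f,h]=[e,g][g,h]$.
   Formalization: That the linked pairs form a semigroup SΩ whose idempotents are exactly the distinct pairs (γ(c,d),δ(c,d)) and generate a regular subsemigroup is taken as an explicit hypothesis on Ω, as it does not follow from the stated definition of a cross-connection. *)

(* Defs.v *)
From Stdlib Require Import ClassicalEpsilon FunctionalExtensionality
  PropExtensionality ProofIrrelevance.

Set Implicit Arguments.
Unset Strict Implicit.

(* Composition is written in diagrammatic order: [f ;; g] is "f, then g". *)
Record Category : Type := {
  Ob :> Type;
  Hom : Ob -> Ob -> Type;
  idm : forall a, Hom a a;
  comp : forall a b c, Hom a b -> Hom b c -> Hom a c;
  comp_id_l : forall a b (f : Hom a b), comp (idm a) f = f;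
  comp_id_r : forall a b (f : Hom a b), comp f (idm b) = f;
  comp_assoc : forall a b c d (f : Hom a b) (g : Hom b c) (h : Hom c d),
    comp f (comp g h) = comp (comp f g) h
}.
Arguments Hom {_} _ _.
Arguments idm {_} _.
Arguments comp {_ a b c} _ _.
Notation "f ;; g" := (comp f g) (at level 40, left associativity).

(* Morphisms with their domain and codomain, so that an equality or an order
   relation may be stated between morphisms of different hom-sets. *)
Record Arrow (C : Category) : Type := arrow {
  src : C;
  tgt : C;
  mor : Hom src tgt
}.
Arguments arrow {C src tgt} mor.
Arguments src {C} _.
Arguments tgt {C} _.
Arguments mor {C} _.

Section Morphisms.
Context {C : Category}.
Definition monic {a b : C} (f : Hom a b) : Prop :=
  forall (x : C) (g h : Hom x a), g ;; f = h ;; f -> g = h.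
Definition epic {a b : C} (f : Hom a b) : Prop :=
  forall (x : C) (g h : Hom b x), f ;; g = f ;; h -> g = h.
Definition bimorphism {a b : C} (f : Hom a b) : Prop := monic f /\ epic f.
Definition is_iso {a b : C} (f : Hom a b) : Prop :=
  exists g : Hom b a, f ;; g = idm a /\ g ;; f = idm b.
End Morphisms.

Record Functor (C D : Category) : Type := {
  fob :> C -> D;
  fmap : forall a b, Hom a b -> Hom (fob a) (fob b);
  fmap_id : forall a, fmap (idm a) = idm (fob a);
  fmap_comp : forall a b c (f : Hom a b) (g : Hom b c),
    fmap (f ;; g) = fmap f ;; fmap g
}.
Arguments fmap {C D} _ {a b} _.

Definition bijective {A B : Type} (f : A -> B) : Prop :=
  (forall x y, f x = f y -> x = y) /\ (forall y, exists x, f x = y).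

Definition fully_faithful {C D : Category} (F : Functor C D) : Prop :=
  forall a b : C, bijective (fun f : Hom a b => fmap F f).

Definition cat_isomorphism {C D : Category} (F : Functor C D) : Prop :=
  bijective (fob F) /\ fully_faithful F.

Record NatTrans {C D : Category} (F G : Functor C D) : Type := {
  ntc :> forall c : C, Hom (F c) (G c);
  nt_nat : forall a b (f : Hom a b), fmap F f ;; ntc b = ntc a ;; fmap G f
}.

Lemma NatTrans_eq {C D : Category} (F G : Functor C D) (s t : NatTrans F G) :
  (forall c, s c = t c) -> s = t.
Proof.
  destruct s as [s Hs], t as [t Ht]; simpl; intro H.
  assert (E : s = t) by (apply functional_extensionality_dep; exact H).
  subst t; f_equal; apply proof_irrelevance.
Qed.

Definition FunctorCat (C D : Category) : Category.
Proof.
  refine {| Ob := Functor C D; Hom := @NatTrans C D;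
            idm := fun F => {| ntc := fun c => idm (F c) |};
            comp := fun F G K s t => {| ntc := fun c => s c ;; t c |} |};
    intros; try (apply NatTrans_eq; simpl; intros).
  - apply comp_id_l.
  - apply comp_id_r.
  - apply comp_assoc.
  Unshelve.
  + intros; simpl; now rewrite comp_id_l, comp_id_r.
  + intros; simpl; rewrite comp_assoc, nt_nat, <- !comp_assoc; f_equal.
    apply nt_nat.
Defined.

Definition full_subcat (C : Category) (P : C -> Prop) : Category := {|
  Ob := {x : C | P x};
  Hom := fun x y => Hom (proj1_sig x) (proj1_sig y);
  idm := fun x => idm (proj1_sig x);
  comp := fun x y z f g => f ;; g;
  comp_id_l := fun x y f => comp_id_l f;
  comp_id_r := fun x y f => comp_id_r f;
  comp_assoc := fun x y z w f g h => comp_assoc f g h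
|}.

(* The category of subsets of [X] and all functions between them.  It plays the
   role of [Set] for functors whose values are sets of elements of [X]; for
   these, equality and inclusion of values are those of subsets. *)
Definition SetsIn (X : Type) : Category := {|
  Ob := X -> Prop;
  Hom := fun A B => {x : X | A x} -> {x : X | B x};
  idm := fun A x => x;
  comp := fun A B C f g x => g (f x);
  comp_id_l := fun A B f => eq_refl;
  comp_id_r := fun A B f => eq_refl;
  comp_assoc := fun A B C D f g h => eq_refl
|}.

Record CatIncl : Type := {
  ci_cat :> Category;
  incl : forall a b : ci_cat, Hom a b -> Prop
}.
Arguments incl {c a b} _.

Definition subobj {C : CatIncl} (a b : C) : Prop :=
  exists j : Hom a b, incl j.

Record with_subobjects (C : CatIncl) : Prop := {
  incl_id : forall a : C, incl (idm a);
  incl_comp : forall (a b c : C) (f : Hom a b) (g : Hom b c),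
    incl f -> incl g -> incl (f ;; g);
  incl_unique : forall (a b : C) (f g : Hom a b), incl f -> incl g -> f = g;
  incl_strict : forall a b : C, subobj a b -> subobj b a -> a = b;
  incl_monic : forall (a b : C) (f : Hom a b), incl f -> monic f;
  incl_cancel : forall (a b c : C) (h : Hom a b) (g : Hom b c) (f : Hom a c),
    incl f -> incl g -> f = h ;; g -> incl h
}.

Section Subobjects.
Context {C : CatIncl}.

Definition retraction {a b : C} (q : Hom a b) : Prop :=
  exists j : Hom b a, incl j /\ j ;; q = idm b.

(* [epi_component f e]: [e] is the component [q ;; u] of a consistent
   factorisation [f = q ;; u ;; j]; the codomain of [e] is the image of [f]. *)
Definition epi_component {a b m : C} (f : Hom a b) (e : Hom a m) : Prop :=
  exists (a' : C) (q : Hom a a') (u : Hom a' m) (j : Hom m b),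
    retraction q /\ bimorphism u /\ incl j /\ f = q ;; u ;; j /\ e = q ;; u.

Definition is_image {a b : C} (f : Hom a b) (m : C) : Prop :=
  exists e : Hom a m, epi_component f e.

Definition has_normal_factorisation {a b : C} (f : Hom a b) : Prop :=
  exists (a' m : C) (q : Hom a a') (u : Hom a' m) (j : Hom m b),
    retraction q /\ is_iso u /\ incl j /\ f = q ;; u ;; j.

Definition ideal (c : C) : Category := full_subcat (fun x : C => subobj x c).

Inductive core_hom (c : C) : forall a b : C, Hom a b -> Prop :=
| core_incl : forall (a b : C) (j : Hom a b),
    subobj a c -> subobj b c -> incl j -> core_hom c j
| core_retr : forall (a b : C) (q : Hom a b),
    subobj a c -> subobj b c -> retraction q -> core_hom c q
| core_id : forall a : C, subobj a c -> core_hom c (idm a)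
| core_comp : forall (x y z : C) (f : Hom x y) (g : Hom y z),
    core_hom c f -> core_hom c g -> core_hom c (f ;; g).

End Subobjects.

Lemma sig_eq {A : Type} {P : A -> Prop} (x y : {a | P a}) :
  proj1_sig x = proj1_sig y -> x = y.
Proof.
  destruct x as [x p], y as [y q]; simpl; intro; subst y.
  f_equal; apply proof_irrelevance.
Qed.

(* The category written <c>. *)
Definition core {C : CatIncl} (c : C) : Category.
Proof.
  refine {| Ob := {x : C | subobj x c};
            Hom := fun x y =>
              {f : Hom (proj1_sig x) (proj1_sig y) | core_hom c f};
            idm := fun x => exist _ (idm (proj1_sig x)) (core_id (proj2_sig x));
            comp := fun x y z f g =>
              exist _ (proj1_sig f ;; proj1_sig g)
                (core_comp (proj2_sig f) (proj2_sig g)) |};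
    intros; apply sig_eq; simpl.
  - apply comp_id_l.
  - apply comp_id_r.
  - apply comp_assoc.
Defined.

Section ConsistentBimorphism.
Context {C : CatIncl} {c d : C}.

Definition extends_image_functor (u : Hom c d) (T : Functor (core c) (core d))
    : Prop :=
  (forall (x : core c) (j : Hom (proj1_sig x) c),
     incl j -> is_image (j ;; u) (proj1_sig (T x))) /\
  (forall (x y : core c) (f : Hom x y),
     incl (proj1_sig f) -> incl (proj1_sig (fmap T f))).

(* The components c' -> T(c') are the morphisms (j_{c'}^c u)°.  They are
   bimorphisms of C; asking them to be invertible in C would force every
   consistent bimorphism (their value at c' = c) to be an isomorphism. *)
Definition image_natural (u : Hom c d) (T : Functor (core c) (core d)) : Prop :=
  exists theta : forall x : core c, Hom (proj1_sig x) (proj1_sig (T x)),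
    (forall (x : core c) (j : Hom (proj1_sig x) c),
       incl j -> epi_component (j ;; u) (theta x)) /\
    (forall x : core c, bimorphism (theta x)) /\
    (forall (x y : core c) (f : Hom x y),
       proj1_sig f ;; theta y = theta x ;; proj1_sig (fmap T f)).

Definition consistent_bimorphism (u : Hom c d) : Prop :=
  bimorphism u /\
  exists! T : Functor (core c) (core d),
    extends_image_functor u T /\ cat_isomorphism T /\ image_natural u T.

End ConsistentBimorphism.

Record ConeTo {C : CatIncl} (c : C) : Type := {
  leg :> forall a : C, Hom a c;
  leg_incl : forall (a b : C) (j : Hom a b), incl j -> j ;; leg b = leg a
}.

Definition Cone (C : CatIncl) : Type := {c : C & ConeTo c}.
Definition cone {C : CatIncl} {c : C} (g : ConeTo c) : Cone C := existT _ c g.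
Definition apex {C : CatIncl} (g : Cone C) : C := projT1 g.
Definition legs {C : CatIncl} (g : Cone C) : ConeTo (apex g) := projT2 g.

Definition consistent_cone {C : CatIncl} {c : C} (g : ConeTo c) : Prop :=
  exists a : C, bimorphism (g a).

Record consistent_category (C : CatIncl) : Prop := {
  cc_subobjects : with_subobjects C;
  cc_split : forall (a b : C) (j : Hom a b),
    incl j -> exists q : Hom b a, j ;; q = idm a;
  cc_factor : forall (a b : C) (f : Hom a b), exists m : C, is_image f m;
  cc_bimorphism : forall (a b : C) (u : Hom a b),
    bimorphism u -> consistent_bimorphism u;
  cc_normal : forall (a b c : C) (j : Hom a b) (q : Hom b c),
    incl j -> retraction q -> has_normal_factorisation (j ;; q);
  cc_cone : forall c : C, exists e : ConeTo c, consistent_cone e /\ e c = idm c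
}.

Record ConsistentCategory : Type := {
  con_cat :> CatIncl;
  con_ax : consistent_category con_cat
}.

Section Dual.
Variable C : ConsistentCategory.

Lemma epi_part_exists (a b : C) (f : Hom a b) :
  exists p : {m : C & Hom a m}, epi_component f (projT2 p).
Proof.
  destruct (cc_factor (con_ax C) f) as [m [e He]].
  now exists (existT _ m e).
Qed.

(* [epi f] is f°, and [im f] its codomain. *)
Definition epi_part (a b : C) (f : Hom a b) : {m : C & Hom a m} :=
  proj1_sig (constructive_indefinite_description _ (epi_part_exists f)).
Definition im {a b : C} (f : Hom a b) : C := projT1 (epi_part f).
Definition epi {a b : C} (f : Hom a b) : Hom a (im f) := projT2 (epi_part f).

Lemma epi_spec (a b : C) (f : Hom a b) : epi_component f (epi f).
Proof.
  exact (proj2_sig (constructive_indefinite_description _ (epi_part_exists f))).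
Qed.

Definition star {c d : C} (g : ConeTo c) (f : Hom c d) : ConeTo d.
Proof.
  refine {| leg := fun a => g a ;; f |}.
  intros a b j Hj; now rewrite comp_assoc, (leg_incl g Hj).
Defined.

Definition cone_mul (g h : Cone C) : Cone C :=
  cone (star (legs g) (epi (legs h (apex g)))).

Definition IdemCone (c : C) : Type :=
  {e : ConeTo c | consistent_cone e /\ e c = idm c}.
Definition idem_cone {c : C} (e : IdemCone c) : ConeTo c := proj1_sig e.

Definition H_set {c : C} (e : IdemCone c) (b : C) (x : Cone C) : Prop :=
  exists f : Hom c b, x = cone (star (idem_cone e) (epi f)).

(* The component at [b] of the natural bijection eta_e : e * f° |-> f. *)
Definition eta {c : C} (e : IdemCone c) (b : C) (x : {x | H_set e b x})
    : Hom c b :=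
  proj1_sig (constructive_indefinite_description _ (proj2_sig x)).

Lemma eta_spec (c : C) (e : IdemCone c) (b : C) (x : {x | H_set e b x}) :
  proj1_sig x = cone (star (idem_cone e) (epi (eta x))).
Proof.
  exact (proj2_sig (constructive_indefinite_description _ (proj2_sig x))).
Qed.

Lemma star_epi_inj (c : C) (e : IdemCone c) (b : C) (f g : Hom c b) :
  cone (star (idem_cone e) (epi f)) = cone (star (idem_cone e) (epi g)) ->
  f = g.
Proof.
  intro E.
  pose (at_c := fun x : Cone C =>
    existT (fun m : C => Hom c m) (apex x) (legs x c)).
  assert (A : forall h : Hom c b,
      at_c (cone (star (idem_cone e) (epi h))) = existT _ (im h) (epi h)).
  { intro h; unfold at_c, idem_cone; simpl.
    now rewrite (proj2 (proj2_sig e)), comp_id_l. }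
  apply (f_equal at_c) in E; rewrite !A in E.
  destruct (epi_spec f) as (a1 & q1 & u1 & j1 & _ & _ & J1 & F1 & E1).
  destruct (epi_spec g) as (a2 & q2 & u2 & j2 & _ & _ & J2 & F2 & E2).
  rewrite <- E1 in F1; rewrite <- E2 in F2.
  pose (P := fun y : {m : C & Hom c m} => forall j : Hom (projT1 y) b,
    incl j -> epi f ;; j1 = projT2 y ;; j).
  assert (Q : P (existT _ (im g) (epi g))).
  { rewrite <- E; intros j Hj; simpl in *.
    now rewrite (incl_unique (cc_subobjects (con_ax C)) J1 Hj). }
  rewrite F1, F2; exact (Q j2 J2).
Qed.

Definition H_fun {c : C} (e : IdemCone c) : Functor C (SetsIn (Cone C)).
Proof.
  refine (@Build_Functor C (SetsIn (Cone C)) (fun b => H_set e b)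
    (fun a b g x => exist (H_set e b)
       (cone (star (idem_cone e) (epi (eta x ;; g))))
       (ex_intro _ (eta x ;; g) eq_refl)) _ _).
  - intro a; apply functional_extensionality; intro x.
    apply sig_eq; simpl; rewrite comp_id_r; symmetry; apply eta_spec.
  - intros a b d f g; apply functional_extensionality; intro x.
    apply sig_eq; simpl; rewrite comp_assoc.
    match goal with |- _ = cone (star _ (epi (eta ?y ;; _))) => set (z := y) end.
    assert (Z : eta z = eta x ;; f).
    { apply (star_epi_inj (e := e)); now rewrite <- eta_spec. }
    now rewrite Z.
Defined.

(* The consistent dual; its inclusions are the inclusions of subfunctors. *)
Definition dual : CatIncl := {|
  ci_cat := full_subcat (C := FunctorCat C (SetsIn (Cone C)))
    (fun F => exists (c : C) (e : IdemCone c), F = H_fun e);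
  incl := fun F G (t : NatTrans (proj1_sig F) (proj1_sig G)) =>
    forall (c : C) (x : {x | proj1_sig F c x}),
      proj1_sig (t c x) = proj1_sig x
|}.

Definition dual_fun (F : dual) : Functor C (SetsIn (Cone C)) := proj1_sig F.

Definition M_set (F : dual) (c : C) : Prop :=
  exists (a : C) (e : IdemCone a), dual_fun F = H_fun e /\ is_iso (idem_cone e c).

Lemma IdemCone_inhabited (c : C) : inhabited (IdemCone c).
Proof.
  destruct (cc_cone (con_ax C) c) as [e He]; constructor; now exists e.
Qed.

Lemma Hom_inhabited (a c : C) : inhabited (Hom a c).
Proof. destruct (cc_cone (con_ax C) c) as [e _]; constructor; exact (e a). Qed.

(* The idempotent cone [e] with apex [c] such that F = H(e;-), for [c] in MF;
   unspecified for other [c]. *)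
Definition cone_of (F : dual) (c : C) : IdemCone c :=
  epsilon (IdemCone_inhabited c) (fun e => dual_fun F = H_fun e).

End Dual.

Arguments epi {C a b} _.
Arguments im {C a b} _.
Arguments star {C c d} _ _.
Arguments idem_cone {C c} _.

Definition inclusion_preserving {C D : CatIncl} (F : Functor C D) : Prop :=
  forall (a b : C) (j : Hom a b), incl j -> incl (fmap F j).

Lemma preserves_subobj {C D : CatIncl} {F : Functor C D} :
  inclusion_preserving F -> forall a b : C, subobj a b -> subobj (F a) (F b).
Proof. intros HF a b [j Hj]; exists (fmap F j); now apply HF. Qed.

Definition restrict_ideal {C D : CatIncl} (F : Functor C D)
    (HF : inclusion_preserving F) (c : C) : Functor (ideal c) (ideal (F c)) :=
  @Build_Functor (ideal c) (ideal (F c))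
    (fun x => exist _ (F (proj1_sig x)) (preserves_subobj HF (proj2_sig x)))
    (fun x y f => fmap F f)
    (fun x => fmap_id F (proj1_sig x))
    (fun x y z f g => fmap_comp F f g).

Definition local_isomorphism {C D : CatIncl} (F : Functor C D) : Prop :=
  exists HF : inclusion_preserving F,
    fully_faithful F /\ forall c : C, cat_isomorphism (restrict_ideal HF c).

Record CrossConnection (C D : ConsistentCategory) : Type := {
  Gam : Functor D (dual C);
  Del : Functor C (dual D);
  Gam_local : local_isomorphism Gam;
  Del_local : local_isomorphism Del;
  cross : forall (c : C) (d : D), M_set (Gam d) c <-> M_set (Del c) d
}.

(* A semigroup, given as a subset [mem] of a type closed under [mul] (closure and
   associativity are part of [regular_biordered_set]), together with an indexing
   [emb] of its idempotents by [E]. *)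
Record IdemSystem (E : Type) : Type := {
  elt : Type;
  mem : elt -> Prop;
  mul : elt -> elt -> elt;
  emb : E -> elt
}.
Arguments elt {E} _.
Arguments mem {E} _ _.
Arguments mul {E} _ _ _.
Arguments emb {E} _ _.

Definition opposite_system {E : Type} (B : IdemSystem E) : IdemSystem E := {|
  elt := elt B; mem := mem B; mul := fun x y => mul B y x; emb := emb B |}.

Section Biordered.
Context {E : Type} (B : IdemSystem E).

Inductive generated (A : elt B -> Prop) : elt B -> Prop :=
| gen_base : forall x, A x -> generated A x
| gen_mul : forall x y, generated A x -> generated A y -> generated A (mul B x y).

Definition idempotent (x : elt B) : Prop := mem B x /\ mul B x x = x.

(* [E] is, via [emb], the set of idempotents of a semigroup whose idempotents
   generate a regular subsemigroup. *)
Record regular_biordered_set : Prop := {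
  rb_closed : forall x y, mem B x -> mem B y -> mem B (mul B x y);
  rb_assoc : forall x y z, mem B x -> mem B y -> mem B z ->
    mul B x (mul B y z) = mul B (mul B x y) z;
  rb_emb_inj : forall e f, emb B e = emb B f -> e = f;
  rb_emb_idem : forall x, (exists e, emb B e = x) <-> idempotent x;
  rb_regular : forall x, generated idempotent x ->
    exists y, generated idempotent y /\ mul B (mul B x y) x = x
}.

Definition omega_l (e f : E) : Prop := mul B (emb B e) (emb B f) = emb B e.
Definition omega_r (e f : E) : Prop := mul B (emb B f) (emb B e) = emb B e.
Definition omega (e f : E) : Prop := omega_l e f /\ omega_r e f.
Definition L_rel (e f : E) : Prop := omega_l e f /\ omega_l f e.
Definition R_rel (e f : E) : Prop := omega_r e f /\ omega_r f e.
Definition is_product (e f g : E) : Prop := emb B g = mul B (emb B e) (emb B f).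

(* The square with rows (e, f) and (g, h) is a singular E-square. *)
Definition singular (e f g h : E) : Prop :=
  exists k : E,
    (omega_l e k /\ omega_l f k /\ R_rel e f /\
     is_product k e g /\ is_product k f h) \/
    (omega_r e k /\ omega_r g k /\ L_rel e g /\
     is_product e k f /\ is_product g k h).

(* The subsemigroup <x> generated by the idempotents below [x]. *)
Definition idem_core (x : elt B) : elt B -> Prop :=
  generated (fun g => idempotent g /\ mul B g x = g /\ mul B x g = g).

Record connecting (x e f : elt B) (v : elt B -> elt B) : Prop := {
  cn_range : forall y, idem_core e y -> idem_core f (v y);
  cn_inj : forall y z, idem_core e y -> idem_core e z -> v y = v z -> y = z;
  cn_surj : forall z, idem_core f z -> exists y, idem_core e y /\ v y = z;
  cn_mul : forall y z, idem_core e y -> idem_core e z ->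
    v (mul B y z) = mul B (v y) (v z);
  cn_conn : forall y, idem_core e y -> mul B y x = mul B x (v y)
}.

End Biordered.

Section Ordered.
Context {I : Category} (le : Arrow I -> Arrow I -> Prop).

Definition is_restriction (x : Arrow I) (e : I) (y : Arrow I) : Prop :=
  le y x /\ src y = e.
Definition is_corestriction (x : Arrow I) (f : I) (y : Arrow I) : Prop :=
  le y x /\ tgt y = f.

Record ordered_cancellative_category : Prop := {
  le_refl : forall x, le x x;
  le_trans : forall x y z, le x y -> le y z -> le x z;
  le_antisym : forall x y, le x y -> le y x -> x = y;
  occ1 : forall (a b : I) (x : Hom a b), bimorphism x;
  occ2 : forall (a b c a' b' c' : I) (u : Hom a b) (v : Hom b c)
    (x : Hom a' b') (y : Hom b' c'),
    le (arrow u) (arrow x) -> le (arrow v) (arrow y) ->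
    le (arrow (u ;; v)) (arrow (x ;; y));
  occ3 : forall x y, le x y ->
    le (arrow (idm (src x))) (arrow (idm (src y))) /\
    le (arrow (idm (tgt x))) (arrow (idm (tgt y)));
  occ4 : forall (x : Arrow I) (e : I),
    le (arrow (idm e)) (arrow (idm (src x))) -> exists! y, is_restriction x e y;
  occ5 : forall (x : Arrow I) (f : I),
    le (arrow (idm f)) (arrow (idm (tgt x))) -> exists! y, is_corestriction x f y
}.

(* [dist e f h]: [h] is the distinguished morphism [e,f]. *)
Variable B : IdemSystem I.
Variable dist : forall e f : I, Hom e f -> Prop.

Record distinguished_morphisms : Prop := {
  dist_ex : forall e f, R_rel B e f \/ L_rel B e f ->
    exists! h : Hom e f, dist h;
  dist_dom : forall e f (h : Hom e f), dist h -> R_rel B e f \/ L_rel B e f;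
  dist_id : forall e : I, dist (idm e);
  dist_comp : forall (e f g : I) (h : Hom e f) (k : Hom f g),
    (R_rel B e f /\ R_rel B f g) \/ (L_rel B e f /\ L_rel B f g) ->
    dist h -> dist k -> dist (h ;; k);
  dist_restr : forall (g h e : I) (x : Hom g h), dist x -> omega B e g ->
    exists (f : I) (y : Hom e f),
      emb B f = mul B (mul B (emb B h) (emb B e)) (emb B h) /\
      dist y /\ le (arrow y) (arrow x)
}.

(* [y1], [y2], [y12] are the restrictions of [x] to e1, e2 and e1e2. *)
Definition icc1 : Prop :=
  forall (x : Arrow I) (e1 e2 f1 f2 : I) (y1 : Hom e1 f1) (y2 : Hom e2 f2),
    is_restriction x e1 (arrow y1) -> is_restriction x e2 (arrow y2) ->
    omega_r B e1 e2 ->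
    omega_r B f1 f2 /\
    exists (e12 f12 : I) (y12 : Hom e12 f12) (h : Hom e1 e12) (k : Hom f1 f12),
      is_product B e1 e2 e12 /\ is_product B f1 f2 f12 /\
      is_restriction x e12 (arrow y12) /\ dist h /\ dist k /\
      h ;; y12 = y1 ;; k.

Definition icc2 : Prop :=
  forall (e f g h : I) (ef : Hom e f) (fh : Hom f h) (eg : Hom e g)
    (gh : Hom g h),
    singular B e f g h -> dist ef -> dist fh -> dist eg -> dist gh ->
    ef ;; fh = eg ;; gh.

End Ordered.

Definition opposite_category (I : Category) : Category := {|
  Ob := I;
  Hom := fun a b => @Hom I b a;
  idm := fun a => @idm I a;
  comp := fun a b c f g => @comp I c b a g f;
  comp_id_l := fun a b f => @comp_id_r I b a f;
  comp_id_r := fun a b f => @comp_id_l I b a f;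
  comp_assoc := fun a b c d f g h => eq_sym (@comp_assoc I d c b a h g f)
|}.

Definition unop {I : Category} (x : Arrow (opposite_category I)) : Arrow I :=
  @arrow I (tgt x) (src x) (mor x).

Definition opposite_le {I : Category} (le : Arrow I -> Arrow I -> Prop)
    (x y : Arrow (opposite_category I)) : Prop := le (unop x) (unop y).

Definition opposite_dist {I : Category} (dist : forall e f : I, Hom e f -> Prop)
    (e f : opposite_category I) (h : Hom e f) : Prop := dist f e h.

(* The duals are taken both with respect to the multiplication of the biordered
   set and with respect to the direction of morphisms; the latter exchanges
   restrictions with corestrictions. *)
Record inductive_cancellative_category (I : Category)
    (le : Arrow I -> Arrow I -> Prop) (B : IdemSystem I)
    (dist : forall e f : I, Hom e f -> Prop) : Prop := {
  icc_ordered : ordered_cancellative_category le;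
  icc_biordered : regular_biordered_set B;
  icc_omega : forall e f : I,
    omega B e f <-> le (arrow (idm e)) (arrow (idm f));
  icc_dist : distinguished_morphisms le B dist;
  icc_1 : icc1 le B dist;
  icc_1_mul : icc1 le (opposite_system B) dist;
  icc_1_op : icc1 (I := opposite_category I) (opposite_le le) B
    (opposite_dist dist);
  icc_1_mul_op : icc1 (I := opposite_category I) (opposite_le le)
    (opposite_system B) (opposite_dist dist);
  icc_2 : icc2 B dist;
  icc_2_mul : icc2 (opposite_system B) dist;
  icc_2_op : icc2 (I := opposite_category I) B (opposite_dist dist);
  icc_2_mul_op : icc2 (I := opposite_category I) (opposite_system B)
    (opposite_dist dist)
}.

Section CrossConnectionSemigroup.
Context {C D : ConsistentCategory} (Om : CrossConnection C D).

Definition E_Om : Type := {p : C * D | M_set (Gam Om (snd p)) (fst p)}.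
Definition fstE (e : E_Om) : C := fst (proj1_sig e).
Definition sndE (e : E_Om) : D := snd (proj1_sig e).

Definition gamma (c : C) (d : D) : ConeTo c := idem_cone (cone_of (Gam Om d) c).
Definition delta (c : C) (d : D) : ConeTo d := idem_cone (cone_of (Del Om c) d).

(* The identity D(g,-) = eta^{-1} Delta(f) eta evaluated at h : d -> b, where
   eta^{-1} sends h to delta(c',d) * h°, and eta sends delta(c,d') * k° to k. *)
Definition is_transpose {c' c : C} (f : Hom c' c) {d d' : D} (g : Hom d' d)
    : Prop :=
  forall (b : D) (h : Hom d b)
    (p : dual_fun (Del Om c') b (cone (star (delta c' d) (epi h)))),
    proj1_sig (fmap (Del Om) f b (exist _ _ p)) =
    cone (star (delta c d') (epi (g ;; h))).

(* Specified for d in M Delta(c') and d' in M Delta(c). *)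
Definition transpose {c' c : C} (f : Hom c' c) (d d' : D) : Hom d' d :=
  epsilon (Hom_inhabited d' d) (fun g => is_transpose f g).

Definition Gam_set (c : C) (d : D) : Cone C -> Prop := dual_fun (Gam Om d) c.

(* The graph of chi(c,d). *)
Definition chi (c : C) (d : D) (x : Cone C) (y : Cone D) : Prop :=
  exists (c' : C) (d' : D) (f : Hom c' c),
    M_set (Gam Om d) c' /\ M_set (Del Om c) d' /\
    x = cone (star (gamma c' d) (epi f)) /\
    y = cone (star (delta c d') (epi (transpose f d d'))).

Definition linked (p : Cone C * Cone D) : Prop :=
  exists (c : C) (d : D), Gam_set c d (fst p) /\ chi c d (fst p) (snd p).

Definition S_Om : IdemSystem E_Om := {|
  elt := Cone C * Cone D;
  mem := linked;
  mul := fun p q => (cone_mul (fst p) (fst q), cone_mul (snd q) (snd p));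
  emb := fun e => (cone (gamma (fstE e) (sndE e)), cone (delta (fstE e) (sndE e)))
|}.

Lemma bimorphism_id (a : C) : bimorphism (idm a).
Proof.
  split; intros x g h E.
  - now rewrite !comp_id_r in E.
  - now rewrite !comp_id_l in E.
Qed.

Lemma bimorphism_comp (a b c : C) (f : Hom a b) (g : Hom b c) :
  bimorphism f -> bimorphism g -> bimorphism (f ;; g).
Proof.
  intros [F1 F2] [G1 G2]; split; intros x h k E.
  - rewrite !comp_assoc in E; now apply F1, G1.
  - rewrite <- !comp_assoc in E; now apply G2, F2.
Qed.

Definition I_Om : Category.
Proof.
  refine {| Ob := E_Om;
            Hom := fun e f => {u : Hom (fstE e) (fstE f) | bimorphism u};
            idm := fun e => exist _ (idm (fstE e)) (bimorphism_id (fstE e));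
            comp := fun e f g u v => exist _ (proj1_sig u ;; proj1_sig v)
              (bimorphism_comp (proj2_sig u) (proj2_sig v)) |};
    intros; apply sig_eq; simpl.
  - apply comp_id_l.
  - apply comp_id_r.
  - apply comp_assoc.
Defined.

Definition under (u : Arrow I_Om) : Arrow C := arrow (proj1_sig (mor u)).

Definition x_elt (u : Arrow I_Om) : elt S_Om :=
  (cone (star (gamma (fstE (src u)) (sndE (src u))) (mor (under u))),
   cone (star (delta (fstE (tgt u)) (sndE (tgt u)))
     (transpose (mor (under u)) (sndE (src u)) (sndE (tgt u))))).

Definition connecting_iso (u : Arrow I_Om) (v : elt S_Om -> elt S_Om) : Prop :=
  connecting (x_elt u) (emb S_Om (src u)) (emb S_Om (tgt u)) v.

Definition subE (e f : E_Om) : Prop :=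
  subobj (fstE e) (fstE f) /\ subobj (sndE e) (sndE f).

(* [v] is (j_{c1}^c u)° as a morphism of C, where c1 is the first component of
   the domain of [v]. *)
Definition restricted_component (v u : Arrow I_Om) : Prop :=
  exists j : Hom (fstE (src v)) (fstE (src u)),
    incl j /\ under v = arrow (epi (j ;; mor (under u))).

Definition le_Om (u1 u2 : Arrow I_Om) : Prop :=
  subE (src u1) (src u2) /\ restricted_component u1 u2 /\
  exists v, connecting_iso u2 v /\ emb S_Om (tgt u1) = v (emb S_Om (src u1)).

Definition dist_Om (e f : I_Om) (u : Hom e f) : Prop :=
  (R_rel S_Om e f \/ L_rel S_Om e f) /\
  proj1_sig u = gamma (fstE f) (sndE f) (fstE e).

Definition restriction_Om (u : Arrow I_Om) (e : I_Om) (w : Arrow I_Om) : Prop :=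
  src w = e /\ subE e (src u) /\ restricted_component w u /\
  exists v, connecting_iso u v /\ emb S_Om (tgt w) = v (emb S_Om e).

Definition corestriction_Om (u : Arrow I_Om) (f : I_Om) (w : Arrow I_Om) : Prop :=
  tgt w = f /\ subE (src w) (src u) /\ restricted_component w u /\
  exists v, connecting_iso u v /\ v (emb S_Om (src w)) = emb S_Om f.

End CrossConnectionSemigroup.

(* Main.v *)
From Stdlib Require Import ClassicalEpsilon FunctionalExtensionality
  PropExtensionality ProofIrrelevance.
Require Import Defs.

(** Let e = (c,d) and f = (c',d') be idempotents of the cross-connection
    semigroup.  A morphism g : c -> c' gives the element
    x_g = (gamma_e * g°, delta_f * (g‡)°), where gamma_e and delta_e denote the
    two cones of e.  The leg of an idempotent cone at a subobject of its apex is
    an inclusion, and transposition is a contravariant functor, so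
    x_g x_h = x_(g h); moreover g is read off from x_g.  Hence, between fixed
    idempotents, computing in the semigroup is composing morphisms of C
    ([morphism_elt_mul], [morphism_elt_inj]).

    Let e1 = (c1,d1) be below e, with inclusion i : c1 -> c and retraction
    q = gamma_e1(c).  Then e1 is the element x_(q i) ([emb_below]): this element
    is idempotent, hence comes from some pair, and inside the ideal of d a pair is
    known by its first cone, because the local isomorphism to the dual is
    injective on ideals.  For a bimorphism u : c -> c', the equation
    y x_u = x_u z between elements y = x_g and z = x_h says that g u = u h.
    As u is cancellable on both sides, this relation between y and z
    ([conjugate]) is multiplicative, functional and injective.

    Consistency of u carries the inclusion and retraction of e1 to an inclusion
    and a retraction of a subobject of c', compatibly with u, and conversely
    ([bimorphism_restrict], [bimorphism_corestrict]); surjectivity of the local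
    isomorphism on ideals makes the new pair into an idempotent below f.  This
    gives the connecting isomorphism, and shows that u1 <= u means that u1
    commutes with u through both the inclusions and the retractions
    ([le_Om_iff]).  In this form reflexivity, transitivity, compatibility with
    composition, restriction and corestriction are immediate.

    The distinguished morphism from e to f is the leg gamma_f(c).  The remaining
    axioms compare legs: if d1 is a subobject of d then gamma_e1 is gamma_e
    followed by gamma_e1(c) ([gamma_factor]), and if c1 is a subobject of c then
    gamma_e(c1) is the inclusion.  When e1 and e2 are both below e, the leg
    gamma_e2(c1) is the inclusion of c1 followed by the retraction onto c2, and
    both commute with restrictions of u ([restricts_leg]); the two composites
    around a singular square are one and the same leg ([singular_commutes]). *)

Set Implicit Arguments.
Unset Strict Implicit.

(** * Epimorphisms, inclusions and images *)

Section Epimorphisms.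
Context {C : Category}.

Lemma epic_comp (a b c : C) (f : Hom a b) (g : Hom b c) :
  epic f -> epic g -> epic (f ;; g).
Proof.
  intros F G x h k E; rewrite <- !comp_assoc in E; now apply G, F.
Qed.

Lemma epic_right (a b c : C) (f : Hom a b) (g : Hom b c) :
  epic (f ;; g) -> epic g.
Proof.
  intros F x h k E; apply F; now rewrite <- !comp_assoc, E.
Qed.

Lemma epic_id (a : C) : epic (idm a).
Proof. intros x h k E; now rewrite !comp_id_l in E. Qed.

Lemma split_epic (a b : C) (j : Hom b a) (q : Hom a b) : j ;; q = idm b -> epic q.
Proof. intro E; apply (@epic_right _ _ _ j); rewrite E; apply epic_id. Qed.

Lemma iso_bimorphism (a b : C) (f : Hom a b) : is_iso f -> bimorphism f.
Proof.
  intros [g [E1 E2]]; split; intros x h k E.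
  - apply (f_equal (fun z => z ;; g)) in E.
    now rewrite <- !comp_assoc, E1, !comp_id_r in E.
  - apply (f_equal (fun z => g ;; z)) in E.
    now rewrite !comp_assoc, E2, !comp_id_l in E.
Qed.

End Epimorphisms.

Lemma arrow_inj (C : Category) (a b b' : C) (f : Hom a b) (f' : Hom a b') :
  arrow f = arrow f' ->
  existT (fun m : C => Hom a m) b f = existT (fun m : C => Hom a m) b' f'.
Proof.
  intro E.
  apply (f_equal (fun z : Arrow C =>
    existT (fun s : C => {m : C & Hom s m}) (src z) (existT _ (tgt z) (mor z)))) in E.
  exact (inj_pair2 _ _ _ _ _ E).
Qed.

Section Images.
Context {C : ConsistentCategory}.
Let CS := cc_subobjects (con_ax C).

Lemma epic_incl_inverse (a b : C) (j : Hom a b) :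
  incl j -> epic j -> exists k : Hom b a, incl k /\ j ;; k = idm a /\ k ;; j = idm b.
Proof.
  intros J E; destruct (cc_split (con_ax C) J) as [q Q].
  assert (R : q ;; j = idm b).
  { apply E; now rewrite comp_assoc, Q, comp_id_l, comp_id_r. }
  exists q; repeat split; trivial.
  apply (incl_cancel CS (incl_id CS b) J); now symmetry.
Qed.

Lemma incl_endo (a : C) (j : Hom a a) : incl j -> j = idm a.
Proof. intro J; apply (incl_unique CS J (incl_id CS a)). Qed.

(** The two codomains include in each other: split the two inclusions and cancel
    the epimorphisms.  Inclusions form a strict preorder, so the codomains are
    equal and the comparison is the identity. *)
Lemma image_unique (a b m n : C) (e : Hom a m) (i : Hom m b) (f : Hom a n)
    (j : Hom n b) :
  epic e -> incl i -> epic f -> incl j -> e ;; i = f ;; j ->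
  existT (fun m : C => Hom a m) m e = existT (fun m : C => Hom a m) n f.
Proof.
  intros E I F J H.
  destruct (cc_split (con_ax C) I) as [p P], (cc_split (con_ax C) J) as [q Q].
  assert (E1 : f = e ;; (i ;; q)).
  { now rewrite comp_assoc, H, <- comp_assoc, Q, comp_id_r. }
  assert (F1 : e = f ;; (j ;; p)).
  { now rewrite comp_assoc, <- H, <- comp_assoc, P, comp_id_r. }
  assert (I1 : i = (i ;; q) ;; j).
  { apply E; now rewrite H, comp_assoc, <- E1. }
  assert (J1 : j = (j ;; p) ;; i).
  { apply F; now rewrite <- H, comp_assoc, <- F1. }
  pose proof (incl_cancel CS I J I1) as K.
  pose proof (incl_cancel CS J I J1) as L.
  assert (X : m = n) by (apply (incl_strict CS); eexists; eassumption).
  subst n; f_equal; now rewrite E1, (incl_endo K), comp_id_r.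
Qed.

(** Retractions and bimorphisms are epic, so a consistent factorisation is in
    particular an epimorphism followed by an inclusion. *)
Lemma epi_component_factor (a b m : C) (f : Hom a b) (e : Hom a m) :
  epi_component f e -> epic e /\ exists j : Hom m b, incl j /\ f = e ;; j.
Proof.
  intros (a' & q & u & j & [i [_ R]] & [_ U] & J & F & G); subst e; split.
  - apply epic_comp; trivial; exact (split_epic R).
  - now exists j.
Qed.

Lemma epi_factor (a b : C) (f : Hom a b) :
  epic (epi f) /\ exists j : Hom (im f) b, incl j /\ f = epi f ;; j.
Proof. exact (epi_component_factor (epi_spec f)). Qed.

Lemma epi_unique (a b m : C) (f : Hom a b) (e : Hom a m) (j : Hom m b) :
  epic e -> incl j -> f = e ;; j ->
  existT (fun m : C => Hom a m) (im f) (epi f) =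
  existT (fun m : C => Hom a m) m e.
Proof.
  intros E J F; destruct (epi_factor f) as (E' & j' & J' & F').
  apply (image_unique E' J' E J); congruence.
Qed.

Lemma epi_factor_by (a b m : C) (f : Hom a b) (e : Hom a m) (j : Hom m b) :
  existT (fun m : C => Hom a m) (im f) (epi f) =
  existT (fun m : C => Hom a m) m e -> incl j -> f = e ;; j.
Proof.
  intros E J; destruct (epi_factor f) as (_ & i & I & F).
  assert (P : forall z : {m : C & Hom a m},
    existT (fun m : C => Hom a m) (im f) (epi f) = z ->
    forall j : Hom (projT1 z) b, incl j -> f = projT2 z ;; j).
  { intros z <- k K; simpl in *; now rewrite (incl_unique CS K I). }
  exact (P _ E j J).
Qed.

Lemma im_sub (a b : C) (f : Hom a b) : subobj (im f) b.
Proof. destruct (epi_factor f) as (_ & j & J & _); now exists j. Qed.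

(** * Cones *)

Lemma ConeTo_ext (c : C) (g h : ConeTo c) : (forall a, g a = h a) -> g = h.
Proof.
  destruct g as [g G], h as [h H]; simpl; intro E.
  assert (X : g = h) by (apply functional_extensionality_dep; exact E).
  subst h; f_equal; apply proof_irrelevance.
Qed.

Lemma star_star (a b c : C) (g : ConeTo a) (f : Hom a b) (h : Hom b c) :
  star (star g f) h = star g (f ;; h).
Proof. apply ConeTo_ext; intro x; simpl; now rewrite comp_assoc. Qed.

Lemma star_id (a : C) (g : ConeTo a) : star g (idm a) = g.
Proof. apply ConeTo_ext; intro x; simpl; now rewrite comp_id_r. Qed.

Lemma cone_star_eq (a m n : C) (g : ConeTo a) (e : Hom a m) (f : Hom a n) :
  existT (fun m : C => Hom a m) m e = existT (fun m : C => Hom a m) n f ->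
  cone (star g e) = cone (star g f).
Proof.
  intro E; exact (f_equal (fun z : {m : C & Hom a m} => cone (star g (projT2 z))) E).
Qed.

Lemma star_epi (a b m : C) (g : ConeTo a) (f : Hom a b) (e : Hom a m) (j : Hom m b) :
  epic e -> incl j -> f = e ;; j -> cone (star g (epi f)) = cone (star g e).
Proof. intros; now apply cone_star_eq, epi_unique with j. Qed.

Lemma star_epic (a b : C) (g : ConeTo a) (f : Hom a b) :
  epic f -> cone (star g (epi f)) = cone (star g f).
Proof.
  intro F; apply (star_epi g F (incl_id CS b)); now rewrite comp_id_r.
Qed.

Lemma star_epi_id (a : C) (g : ConeTo a) : cone (star g (epi (idm a))) = cone g.
Proof. rewrite (star_epic g (@epic_id _ a)); now rewrite star_id. Qed.

Lemma star_epi_shift (a b c : C) (g : ConeTo a) (f : Hom a b) (h : Hom b c) :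
  epic f -> cone (star (star g f) (epi h)) = cone (star g (epi (f ;; h))).
Proof.
  intro F; destruct (epi_factor h) as (E & j & J & H); rewrite star_star; symmetry.
  apply (@star_epi _ _ _ _ _ _ j); trivial.
  - now apply epic_comp.
  - now rewrite <- comp_assoc, <- H.
Qed.

Lemma cone_leg (c d : C) (g : ConeTo c) (h : ConeTo d) :
  cone g = cone h -> forall a : C,
  existT (fun m : C => Hom a m) c (g a) = existT (fun m : C => Hom a m) d (h a).
Proof.
  intros E a.
  exact (f_equal (fun z : Cone C => existT (fun m : C => Hom a m) (apex z) (legs z a)) E).
Qed.

Lemma cone_leg_star (a b c : C) (g : ConeTo a) (f : Hom a b) (h : ConeTo c) :
  g a = idm a -> cone h = cone (star g f) ->
  existT (fun m : C => Hom a m) c (h a) = existT (fun m : C => Hom a m) b f.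
Proof.
  intros N H; etransitivity; [exact (cone_leg H a)|]; simpl.
  now rewrite N, comp_id_l.
Qed.

Lemma cone_inj (c : C) (g h : ConeTo c) : cone g = cone h -> g = h.
Proof. intro E; exact (inj_pair2 _ _ _ _ _ E). Qed.

Lemma cone_eq_incl (a b : C) (g : ConeTo a) (h : ConeTo b) (k : Hom b a) :
  cone g = cone h -> incl k -> forall x, g x = h x ;; k.
Proof.
  intros E K x; assert (X : a = b) by exact (f_equal (@apex C) E); subst b.
  apply cone_inj in E; subst h; now rewrite (incl_endo K), comp_id_r.
Qed.

Lemma leg_sub (a c : C) (h : ConeTo c) (j : Hom a c) :
  h c = idm c -> incl j -> h a = j.
Proof. intros H J; now rewrite <- (leg_incl h J), H, comp_id_r. Qed.

(** The leg of the second cone at the image of [f] is an inclusion, so the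
    product of the two cones composes [f] with [k]. *)
Lemma cone_mul_star (a b c : C) (g : ConeTo a) (h : ConeTo b) (f : Hom a b)
    (k : Hom b c) :
  h b = idm b ->
  cone_mul (cone (star g (epi f))) (cone (star h (epi k))) =
  cone (star g (epi (f ;; k))).
Proof.
  intro H; unfold cone_mul; simpl.
  destruct (epi_factor f) as (F & i & I & Fi), (epi_factor k) as (K & j & J & Kj).
  rewrite (leg_sub H I).
  destruct (epi_factor (i ;; epi k)) as (L & l & Ll & E).
  rewrite star_star; symmetry.
  apply (star_epi g (epic_comp F L) (incl_comp CS Ll J)).
  rewrite comp_assoc, <- (comp_assoc (epi f)), <- E, comp_assoc, <- Fi.
  now rewrite <- comp_assoc, <- Kj.
Qed.

Lemma cone_mul_sub (a b : C) (g : ConeTo a) (h : ConeTo b) :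
  h b = idm b -> subobj a b -> cone_mul (cone g) (cone h) = cone g.
Proof.
  intros H [j J]; unfold cone_mul; simpl; rewrite (leg_sub H J).
  rewrite (star_epi g (@epic_id _ a) J) by now rewrite comp_id_l.
  now rewrite star_id.
Qed.

Lemma cone_mul_sub_inv (a b : C) (g : ConeTo a) (h : ConeTo b) :
  cone_mul (cone g) (cone h) = cone g -> subobj a b.
Proof.
  intro E; apply (f_equal (@apex C)) in E; unfold cone_mul in E; simpl in E.
  rewrite <- E; apply im_sub.
Qed.

(** * The functors H(e;-) *)

Lemma idem_cone_apex (c : C) (e : IdemCone c) : idem_cone e c = idm c.
Proof. exact (proj2 (proj2_sig e)). Qed.

Lemma H_fun_map (c : C) (e : IdemCone c) (F : Functor C (SetsIn (Cone C))) :
  F = H_fun e -> forall (a b : C) (g : Hom a b) (f : Hom c a)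
    (p : F a (cone (star (idem_cone e) (epi f)))),
  proj1_sig (fmap F g (exist _ _ p)) = cone (star (idem_cone e) (epi (f ;; g))).
Proof.
  intros -> a b g f p; simpl.
  match goal with |- cone (star _ (epi (?y ;; _))) = _ => assert (Z : y = f) end.
  { apply (star_epi_inj (e := e)); now rewrite <- eta_spec. }
  now rewrite Z.
Qed.

Lemma H_fun_value (c : C) (e : IdemCone c) (F : Functor C (SetsIn (Cone C))) :
  F = H_fun e -> forall (a b : C) (g : Hom a b) (f : Hom c a) (x : {x | F a x}),
  proj1_sig x = cone (star (idem_cone e) (epi f)) ->
  proj1_sig (fmap F g x) = cone (star (idem_cone e) (epi (f ;; g))).
Proof.
  intros E a b g f [x p]; simpl; intros ->; exact (H_fun_map E g p).
Qed.

Lemma set_functor_eq (X : Type) (F G : Functor C (SetsIn X)) :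
  (forall b x, F b x <-> G b x) ->
  (forall (a b : C) (g : Hom a b) x (p : F a x) (p' : G a x),
     proj1_sig (fmap F g (exist _ x p)) = proj1_sig (fmap G g (exist _ x p'))) ->
  F = G.
Proof.
  destruct F as [F mF i1 c1], G as [G mG i2 c2]; simpl; intros E M.
  assert (X1 : F = G).
  { apply functional_extensionality; intro b; apply functional_extensionality; intro x.
    now apply propositional_extensionality. }
  subst G.
  assert (X2 : mF = mG).
  { apply functional_extensionality_dep; intro a.
    apply functional_extensionality_dep; intro b.
    apply functional_extensionality; intro g.
    apply functional_extensionality; intros [x p].
    apply sig_eq; apply M. }
  subst mG; f_equal; apply proof_irrelevance.
Qed.

Lemma H_set_self (c : C) (e : IdemCone c) : H_set e c (cone (idem_cone e)).
Proof. exists (idm c); now rewrite star_epi_id. Qed.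

(** An idempotent cone is recovered from its functor and its apex. *)
Lemma H_fun_inj (c : C) (e e' : IdemCone c) :
  H_fun e = H_fun e' -> idem_cone e = idem_cone e'.
Proof.
  intro E.
  assert (X : H_set e' c (cone (idem_cone e))).
  { change (H_fun e' c (cone (idem_cone e))); rewrite <- E; apply H_set_self. }
  destruct X as [f X]; apply cone_inj; rewrite X.
  pose proof (cone_leg_star (idem_cone_apex e') X) as Y; rewrite idem_cone_apex in Y.
  rewrite <- (cone_star_eq (idem_cone e') Y); now rewrite star_id.
Qed.

Lemma split_cone_consistent (c : C) (g : ConeTo c) :
  g c = idm c -> consistent_cone g.
Proof. intro H; exists c; rewrite H; apply bimorphism_id. Qed.

(** Moving the apex of an idempotent cone along an inverse of one of its legs
    does not change the functor. *)
Lemma H_fun_move (a c : C) (e : IdemCone a) :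
  is_iso (idem_cone e c) -> exists e' : IdemCone c, H_fun e = H_fun e'.
Proof.
  intros [i [I1 I2]].
  assert (N : star (idem_cone e) i c = idm c) by exact I1.
  pose (e' := exist (fun g : ConeTo c => consistent_cone g /\ g c = idm c)
    (star (idem_cone e) i) (conj (split_cone_consistent N) N) : IdemCone c).
  assert (S : forall (b : C) (g : Hom c b),
    cone (star (idem_cone e') (epi g)) = cone (star (idem_cone e) (epi (i ;; g)))).
  { intros b g; apply star_epi_shift; exact (split_epic I1). }
  assert (S' : forall (b : C) (f : Hom a b),
    cone (star (idem_cone e) (epi f)) =
    cone (star (idem_cone e') (epi (idem_cone e c ;; f)))).
  { intros b f; now rewrite S, comp_assoc, I2, comp_id_l. }
  exists e'; apply set_functor_eq.
  - intros b x; split; intros [f ->]; eexists; [apply S' | apply S].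
  - intros b d g x [f Hf] p'; subst x.
    rewrite (H_fun_map (e := e) eq_refl).
    revert p'; rewrite S'; intro p'.
    rewrite (H_fun_map (e := e') eq_refl).
    now rewrite S, !comp_assoc, I2, comp_id_l.
Qed.

Lemma cone_of_spec (F : dual C) (c : C) :
  M_set F c -> dual_fun F = H_fun (cone_of F c).
Proof.
  intros (a & e & E & I); unfold cone_of; apply epsilon_spec.
  destruct (H_fun_move I) as [e' E']; exists e'; congruence.
Qed.

Lemma M_set_intro (F : dual C) (c : C) (e : IdemCone c) :
  dual_fun F = H_fun e -> M_set F c.
Proof.
  intro E; exists c, e; split; trivial; rewrite idem_cone_apex.
  exists (idm c); split; apply comp_id_l.
Qed.

Lemma M_set_inhabited (F : dual C) : exists c, M_set F c.
Proof. destruct (proj2_sig F) as (c & e & E); exists c; exact (M_set_intro E). Qed.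

(** A cone of the larger functor is obtained from its idempotent cone by one
    morphism, which the leg at the apex identifies. *)
Lemma cone_factor (c c' : C) (e : IdemCone c) (e' : IdemCone c') :
  H_set e c' (cone (idem_cone e')) ->
  forall a : C, idem_cone e' a = idem_cone e a ;; idem_cone e' c.
Proof.
  intros [f X] a.
  pose proof (cone_leg_star (idem_cone_apex e) X) as Y.
  pose proof (cone_leg X a) as Z; simpl in Z.
  apply (f_equal (fun z : {m : C & Hom c m} =>
    existT (fun m : C => Hom a m) _ (idem_cone e a ;; projT2 z))) in Y.
  simpl in Y; rewrite <- Y in Z; exact (inj_pair2 _ _ _ _ _ Z).
Qed.

(** Puts an element of H(e';-) in the form of an element of H(e;-). *)
Lemma idem_star_shift (c c' : C) (e : IdemCone c) (e' : IdemCone c') (b : C)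
    (q : Hom c c') (f : Hom c' b) :
  epic q -> idem_cone e' = star (idem_cone e) q ->
  cone (star (idem_cone e') (epi f)) = cone (star (idem_cone e) (epi (q ;; f))).
Proof. intros Q ->; now apply star_epi_shift. Qed.

(** Shrinking an idempotent cone along a retraction gives a subfunctor. *)
Lemma H_fun_retract_sub (F G : dual C) (c c' : C) (e : IdemCone c)
    (e' : IdemCone c') (q : Hom c c') :
  dual_fun F = H_fun e -> dual_fun G = H_fun e' ->
  epic q -> idem_cone e' = star (idem_cone e) q -> subobj G F.
Proof.
  intros EF EG Q S.
  assert (I : forall b x, dual_fun G b x -> dual_fun F b x).
  { intros b x; rewrite EF, EG; intros [f ->]; exists (q ;; f).
    now apply idem_star_shift. }
  assert (N : forall (a b : C) (g : Hom a b),
    (fun x => exist (dual_fun F b) _ (I b _ (proj2_sig (fmap (dual_fun G) g x)))) =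
    (fun x => fmap (dual_fun F) g (exist (dual_fun F a) _ (I a _ (proj2_sig x))))).
  { intros a b g; apply functional_extensionality; intros [x p]; apply sig_eq; simpl.
    generalize (I a x p); intro p'.
    assert (Y : H_set e' a x) by (change (H_fun e' a x); now rewrite <- EG).
    destruct Y as [f ->]; rewrite (H_fun_map EG).
    revert p'; rewrite (idem_star_shift _ Q S); intro p'; rewrite (H_fun_map EF).
    now rewrite (idem_star_shift _ Q S), comp_assoc. }
  exists {| ntc := fun b => (fun x => exist (dual_fun F b) _ (I b _ (proj2_sig x)))
                     : Hom (dual_fun G b) (dual_fun F b);
            nt_nat := N |}.
  intros b x; reflexivity.
Qed.

(** The Yoneda transformation given by a morphism between apices. *)
Lemma H_fun_yoneda (F G : dual C) (c c' : C) (e : IdemCone c)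
    (e' : IdemCone c') (k : Hom c' c) :
  dual_fun F = H_fun e -> dual_fun G = H_fun e' ->
  exists t : Hom F G, forall (b : C) (h : Hom c b)
    (p : dual_fun F b (cone (star (idem_cone e) (epi h)))),
    proj1_sig (t b (exist _ _ p)) = cone (star (idem_cone e') (epi (k ;; h))).
Proof.
  destruct F as [F PF], G as [G PG]; simpl; intros EF EG; subst F G.
  assert (Z : forall (b : C) (h : Hom c b) p, eta (exist (H_set e b)
    (cone (star (idem_cone e) (epi h))) p) = h).
  { intros b h p; apply (star_epi_inj (e := e)); now rewrite <- eta_spec. }
  pose (m := fun (b : C) (x : {x | H_set e b x}) => exist (H_set e' b)
    (cone (star (idem_cone e') (epi (k ;; eta x)))) (ex_intro _ (k ;; eta x) eq_refl)).
  assert (N : forall (a b : C) (g : Hom a b),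
    (fun x => m b (fmap (H_fun e) g x)) = (fun x => fmap (H_fun e') g (m a x))).
  { intros a b g; apply functional_extensionality; intros [x p].
    assert (p' := p); destruct p' as [f ->].
    apply sig_eq; transitivity (cone (star (idem_cone e') (epi (k ;; f ;; g)))).
    - unfold m; simpl; rewrite !Z; now rewrite comp_assoc.
    - symmetry; apply (H_fun_value (e := e') eq_refl); simpl; f_equal; now rewrite Z. }
  exists ({| ntc := m : forall b, Hom (H_fun e b) (H_fun e' b); nt_nat := N |}
    : NatTrans (H_fun e) (H_fun e')).
  intros b h p; simpl; now rewrite Z.
Qed.

End Images.

(** * Local isomorphisms into a dual *)

Section LocalIsomorphism.
Context {A B : ConsistentCategory} (F : Functor B (dual A)).
Hypothesis F_local : local_isomorphism F.

Let cn (a : A) (b : B) : ConeTo a := idem_cone (cone_of (F b) a).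

Lemma cn_apex (a : A) (b : B) : cn a b a = idm a.
Proof. apply idem_cone_apex. Qed.

Lemma dual_value_sub (b b' : B) :
  subobj b b' -> forall c x, dual_fun (F b) c x -> dual_fun (F b') c x.
Proof.
  intros [j J] c x p; destruct F_local as [I _].
  specialize (I _ _ _ J c (exist _ x p)); simpl in I.
  rewrite <- I; exact (proj2_sig (fmap F j c (exist _ x p))).
Qed.

(** [cn a b] belongs to the subfunctor [F b] of [F b'], whose elements all start with
    [cn a' b']. *)
Lemma cn_factor (a a' : A) (b b' : B) :
  M_set (F b) a -> M_set (F b') a' -> subobj b b' ->
  forall x, cn a b x = cn a' b' x ;; cn a b a'.
Proof.
  intros M M' S; apply cone_factor.
  change (H_fun (cone_of (F b') a') a (cone (cn a b))).
  rewrite <- (cone_of_spec M'); apply (dual_value_sub S).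
  rewrite (cone_of_spec M); apply H_set_self.
Qed.

Lemma cn_epic (a a' : A) (b b' : B) :
  M_set (F b) a -> M_set (F b') a' -> subobj b b' -> epic (cn a b a').
Proof.
  intros M M' S; apply (@split_epic _ _ _ (cn a' b' a)).
  rewrite <- (cn_factor M M' S); apply cn_apex.
Qed.

Lemma cn_absorb (a a' : A) (b b' : B) :
  M_set (F b) a -> M_set (F b') a' -> subobj b b' ->
  cone_mul (cone (cn a' b')) (cone (cn a b)) = cone (cn a b).
Proof.
  intros M M' S; unfold cone_mul; simpl.
  rewrite (star_epic _ (cn_epic M M' S)); f_equal; apply ConeTo_ext; intro x.
  symmetry; exact (cn_factor M M' S x).
Qed.

Lemma cn_move (a a' : A) (b : B) (w : Hom a a') :
  M_set (F b) a -> cn a b a' ;; w = idm a' -> w ;; cn a b a' = idm a ->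
  M_set (F b) a' /\ forall x, cn a' b x = cn a b x ;; w.
Proof.
  intros M W1 W2.
  assert (M' : M_set (F b) a').
  { exists a, (cone_of (F b) a); split; [exact (cone_of_spec M) | now exists w]. }
  assert (R : subobj b b) by (exists (idm b); apply incl_id, con_ax).
  split; trivial; intro x; rewrite (cn_factor M' M R); f_equal.
  rewrite <- (comp_id_l (cn a' b a)), <- W2, <- comp_assoc, <- (cn_factor M' M R).
  now rewrite cn_apex, comp_id_r.
Qed.

(** Inside an ideal of [B] an object is known once its functor is. *)
Lemma ideal_determined (a : A) (b b1 b2 : B) :
  subobj b1 b -> subobj b2 b -> M_set (F b1) a -> M_set (F b2) a ->
  (forall x, cn a b1 x = cn a b2 x) -> b1 = b2.
Proof.
  intros S1 S2 M1 M2 E; destruct F_local as [I [_ L]].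
  destruct (L b) as [[J _] _].
  assert (X : exist (fun x => subobj x b) b1 S1 = exist _ b2 S2).
  { apply J; simpl; apply sig_eq; simpl; apply sig_eq.
    change (dual_fun (F b1) = dual_fun (F b2)).
    rewrite (cone_of_spec M1), (cone_of_spec M2); f_equal.
    apply sig_eq, ConeTo_ext, E. }
  exact (f_equal (@proj1_sig _ _) X).
Qed.

(** A retraction out of the apex cuts out a subfunctor of [F b]; the local
    isomorphism is onto the ideal of [F b], so this subfunctor comes from [B]. *)
Lemma ideal_retract (a a1 : A) (b : B) (q : Hom a a1) (i : Hom a1 a) :
  M_set (F b) a -> incl i -> i ;; q = idm a1 ->
  exists b1, subobj b1 b /\ M_set (F b1) a1 /\
    forall x, cn a1 b1 x = cn a b x ;; q.
Proof.
  intros M I Q.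
  assert (N : star (cn a b) q a1 = idm a1).
  { simpl; now rewrite (leg_sub (cn_apex a b) I). }
  pose (e := exist (fun g : ConeTo a1 => consistent_cone g /\ g a1 = idm a1)
    (star (cn a b) q) (conj (split_cone_consistent N) N) : IdemCone a1).
  pose (G := exist (fun G => exists c (e : IdemCone c), G = H_fun e)
    (H_fun e) (ex_intro _ a1 (ex_intro _ e eq_refl)) : dual A).
  assert (S : subobj G (F b)).
  { apply (@H_fun_retract_sub A (F b) G a a1 (cone_of (F b) a) e q); trivial.
    - exact (cone_of_spec M).
    - exact (split_epic Q). }
  destruct F_local as [P [_ L]]; destruct (L b) as [[_ J] _].
  destruct (J (exist _ G S)) as [[b1 S1] E].
  apply (f_equal (@proj1_sig _ _)) in E; simpl in E.
  assert (M1 : M_set (F b1) a1).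
  { exact (@M_set_intro A (F b1) a1 e (f_equal (@dual_fun A) E)). }
  exists b1; repeat split; trivial; intro x.
  pose proof (cone_of_spec M1) as H.
  assert (H' : H_fun e = H_fun (cone_of (F b1) a1)).
  { rewrite <- H; symmetry; exact (f_equal (@dual_fun A) E). }
  apply H_fun_inj in H'; unfold cn; now rewrite <- H'.
Qed.

(** The contravariant correspondence between morphisms of [B] and of [A]: [f] is
    sent by [F] to the Yoneda transformation of [k]. *)
Definition represents {b b' : B} {a a' : A} (f : Hom b b') (k : Hom a' a) : Prop :=
  forall (x : A) (h : Hom a x) (p : dual_fun (F b) x (cone (star (cn a b) (epi h)))),
    proj1_sig (fmap F f x (exist _ _ p)) = cone (star (cn a' b') (epi (k ;; h))).

Lemma dual_value (a x : A) (b : B) (h : Hom a x) :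
  M_set (F b) a -> dual_fun (F b) x (cone (star (cn a b) (epi h))).
Proof. intro M; rewrite (cone_of_spec M); now exists h. Qed.

Lemma dual_value_inv (a x : A) (b : B) (y : Cone A) :
  M_set (F b) a -> dual_fun (F b) x y -> exists h : Hom a x,
    y = cone (star (cn a b) (epi h)).
Proof. intros M; rewrite (cone_of_spec M); trivial. Qed.

(** The Yoneda lemma: evaluate at the identity of [a]. *)
Lemma represents_exists (b b' : B) (a a' : A) (f : Hom b b') :
  M_set (F b) a -> M_set (F b') a' -> exists k : Hom a' a, represents f k.
Proof.
  intros M M'.
  pose (y0 := exist (dual_fun (F b) a) _ (dual_value (idm a) M)).
  destruct (dual_value_inv M' (proj2_sig (fmap F f a y0))) as [k K].
  exists k; intros x h p.
  pose proof (nt_nat (fmap F f) h) as N.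
  apply (f_equal (fun t => proj1_sig (t y0))) in N; simpl in N.
  transitivity (proj1_sig (fmap F f x (fmap (dual_fun (F b)) h y0))).
  { do 2 f_equal; apply sig_eq; simpl; unfold y0.
    rewrite (H_fun_map (cone_of_spec M)); now rewrite comp_id_l. }
  etransitivity; [exact N|].
  exact (H_fun_value (cone_of_spec M') h K).
Qed.

Lemma represents_unique (b b' : B) (a a' : A) (f : Hom b b') (k l : Hom a' a) :
  M_set (F b) a -> represents f k -> represents f l -> k = l.
Proof.
  intros M K L; pose proof (dual_value (idm a) M) as p.
  pose proof (eq_trans (eq_sym (K _ _ p)) (L _ _ p)) as E.
  rewrite !comp_id_r in E; exact (star_epi_inj E).
Qed.

Lemma represents_faithful (b b' : B) (a a' : A) (f g : Hom b b') (k : Hom a' a) :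
  M_set (F b) a -> represents f k -> represents g k -> f = g.
Proof.
  intros M K L; destruct F_local as [_ [FF _]]; apply (proj1 (FF b b')).
  apply (@NatTrans_eq A (SetsIn (Cone A))); intro x.
  apply functional_extensionality; intros [y p]; apply sig_eq.
  assert (p' := p); apply (dual_value_inv M) in p'; destruct p' as [h ->].
  etransitivity; [apply K | symmetry; apply L].
Qed.

Lemma represents_full (b b' : B) (a a' : A) (k : Hom a' a) :
  M_set (F b) a -> M_set (F b') a' -> exists f : Hom b b', represents f k.
Proof.
  intros M M'; destruct F_local as [_ [FF _]].
  destruct (@H_fun_yoneda A (F b) (F b') a a' _ _ k (cone_of_spec M) (cone_of_spec M'))
    as [t T].
  destruct (proj2 (FF b b') t) as [f E]; exists f; intros x h p.
  rewrite E; apply T.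
Qed.

Lemma represents_id (b : B) (a : A) : represents (idm b) (idm a).
Proof. intros x h p; now rewrite fmap_id, comp_id_l. Qed.

Lemma represents_comp (b b' b'' : B) (a a' a'' : A) (f : Hom b b') (g : Hom b' b'')
    (k : Hom a' a) (l : Hom a'' a') :
  represents f k -> represents g l -> represents (f ;; g) (l ;; k).
Proof.
  intros K L x h p; rewrite fmap_comp; simpl.
  assert (V : forall y : {y | dual_fun (F b') x y},
    proj1_sig y = cone (star (cn a' b') (epi (k ;; h))) ->
    proj1_sig (fmap F g x y) = cone (star (cn a'' b'') (epi (l ;; (k ;; h))))).
  { intros [y q]; simpl; intros ->; apply L. }
  rewrite <- comp_assoc; apply V, K.
Qed.

(** Test morphisms out of the domain of [k] are themselves represented, so
    cancelling [k] on the left is cancelling [f] on the right. *)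
Lemma represents_epic (b b' : B) (a a' : A) (f : Hom b b') (k : Hom a' a) :
  M_set (F b) a -> M_set (F b') a' -> represents f k -> monic f ->
  forall (x : A) (b'' : B), M_set (F b'') x ->
  forall g h : Hom a x, k ;; g = k ;; h -> g = h.
Proof.
  intros M M' K N x b'' M'' g h E.
  destruct (represents_full g M'' M) as [m R], (represents_full h M'' M) as [n S].
  assert (m = n); [|subst n; exact (represents_unique M'' R S)].
  apply N; apply (represents_faithful (k := k ;; g) M'').
  - now apply represents_comp.
  - rewrite E; now apply represents_comp.
Qed.

End LocalIsomorphism.

(** * Restricting a bimorphism *)

Section RestrictBimorphism.
Context {C : ConsistentCategory}.
Let CS := cc_subobjects (con_ax C).

Lemma sub_refl (c : C) : subobj c c.
Proof. exists (idm c); apply (incl_id CS). Qed.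

Lemma sub_trans (a b c : C) : subobj a b -> subobj b c -> subobj a c.
Proof. intros [i I] [j J]; exists (i ;; j); now apply (incl_comp CS). Qed.

Let top (c : C) : core c := exist (fun x => subobj x c) c (sub_refl c).

(** The image functor of a bimorphism carries its top object to the codomain, up
    to an inclusion [k] which is epic, hence invertible. *)
Lemma consistent_transport (c d : C) (u : Hom c d) :
  bimorphism u ->
  exists (T : Functor (core c) (core d))
    (theta : forall x : core c, Hom (proj1_sig x) (proj1_sig (T x)))
    (k : Hom (proj1_sig (T (top c))) d) (l : Hom d (proj1_sig (T (top c)))),
    cat_isomorphism T /\
    (forall (x y : core c) (f : Hom x y),
       incl (proj1_sig f) -> incl (proj1_sig (fmap T f))) /\
    (forall x, bimorphism (theta x)) /\
    (forall (x y : core c) (f : Hom x y),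
       proj1_sig f ;; theta y = theta x ;; proj1_sig (fmap T f)) /\
    incl k /\ k ;; l = idm _ /\ l ;; k = idm _ /\ u = theta (top c) ;; k.
Proof.
  intro U; destruct (cc_bimorphism (con_ax C) U) as [_ [T [[[_ I] [L N]] _]]].
  destruct N as (theta & E & B & N).
  destruct (epi_component_factor (E (top c) (idm c) (incl_id CS c))) as (_ & k & K & H).
  simpl in H; rewrite comp_id_l in H.
  assert (KE : epic k).
  { apply (@epic_right _ _ _ _ (theta (top c))).
    exact (eq_ind u (fun z => epic z) (proj2 U) _ H). }
  destruct (epic_incl_inverse K KE) as (l & _ & L1 & L2).
  exists T, theta, k, l; repeat split; trivial; try apply L; apply B.
Qed.

(** Apply the image functor to [i] and [q]; naturality gives the two squares. *)
Lemma bimorphism_restrict (c d c1 : C) (u : Hom c d) (i : Hom c1 c) (q : Hom c c1) :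
  bimorphism u -> incl i -> i ;; q = idm c1 ->
  exists (d1 : C) (w : Hom c1 d1) (j : Hom d1 d) (p : Hom d d1),
    bimorphism w /\ incl j /\ j ;; p = idm d1 /\ i ;; u = w ;; j /\ q ;; w = u ;; p.
Proof.
  intros U I Q.
  destruct (consistent_transport U) as (T & th & k & l & _ & TI & B & N & K & KL & LK & E).
  assert (S1 : subobj c1 c) by now exists i.
  pose (x1 := exist (fun x => subobj x c) c1 S1 : core c).
  pose (ci := exist (fun f => core_hom c f) i (core_incl S1 (sub_refl c) I) : Hom x1 (top c)).
  pose (cq := exist (fun f => core_hom c f) q
    (core_retr (sub_refl c) S1 (ex_intro _ i (conj I Q))) : Hom (top c) x1).
  exists (proj1_sig (T x1)), (th x1), (proj1_sig (fmap T ci) ;; k),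
    (l ;; proj1_sig (fmap T cq)).
  pose proof (N _ _ ci) as Ni; pose proof (N _ _ cq) as Nq; simpl in Ni, Nq.
  refine (conj (B x1) (conj _ (conj _ (conj _ _)))).
  - apply (incl_comp CS); trivial; now apply TI.
  - rewrite comp_assoc, <- (comp_assoc _ k l), KL, comp_id_r.
    change (proj1_sig (fmap T ci ;; fmap T cq) = idm (proj1_sig (T x1))).
    rewrite <- fmap_comp.
    assert (X : ci ;; cq = idm x1) by (apply sig_eq; exact Q).
    now rewrite X, fmap_id.
  - rewrite E, !comp_assoc; exact (f_equal (fun z => z ;; k) Ni).
  - rewrite E, <- comp_assoc, (comp_assoc k l), KL, comp_id_l; exact Nq.
Qed.

(** Fullness and faithfulness of the image functor lift [j] and [p], together with
    the equation between them, to the subobjects of [c]. *)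
Lemma bimorphism_corestrict (c d d1 : C) (u : Hom c d) (j : Hom d1 d) (p : Hom d d1) :
  bimorphism u -> incl j -> j ;; p = idm d1 ->
  exists (c1 : C) (w : Hom c1 d1) (i : Hom c1 c) (q : Hom c c1),
    bimorphism w /\ incl i /\ i ;; q = idm c1 /\ i ;; u = w ;; j /\ q ;; w = u ;; p.
Proof.
  intros U J P.
  destruct (consistent_transport U) as
    (T & th & k & l & [[_ TO] TF] & TI & B & N & K & KL & LK & E).
  assert (S1 : subobj d1 d) by now exists j.
  destruct (TO (exist (fun x => subobj x d) d1 S1)) as [x1 X].
  apply (f_equal (@proj1_sig _ _)) in X; simpl in X; subst d1.
  destruct (proj2_sig x1) as [i I].
  pose (ci := exist (fun f => core_hom c f) i
    (core_incl (proj2_sig x1) (sub_refl c) I) : Hom x1 (top c)).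
  assert (KP : core_hom d (k ;; p)).
  { apply (core_comp (core_incl (proj2_sig (T (top c))) (sub_refl d) K)).
    apply (core_retr (sub_refl d) S1); now exists j. }
  destruct (proj2 (TF (top c) x1) (exist _ _ KP)) as [q Q].
  apply (f_equal (@proj1_sig _ _)) in Q; simpl in Q.
  assert (TJ : proj1_sig (fmap T ci) ;; k = j).
  { apply (incl_unique CS); trivial; apply (incl_comp CS); trivial; now apply TI. }
  exists (proj1_sig x1), (th x1), i, (proj1_sig q).
  pose proof (N _ _ ci) as Ni; pose proof (N _ _ q) as Nq; simpl in Ni, Nq.
  refine (conj (B x1) (conj I (conj _ (conj _ _)))).
  - assert (Z : ci ;; q = idm x1); [|exact (f_equal (@proj1_sig _ _) Z)].
    apply (proj1 (TF x1 x1)); cbv beta; rewrite fmap_comp, fmap_id; apply sig_eq; simpl.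
    rewrite Q, comp_assoc, TJ; exact P.
  - rewrite E, <- TJ, !comp_assoc; exact (f_equal (fun z => z ;; k) Ni).
  - rewrite E, <- comp_assoc, <- Q; exact Nq.
Qed.

End RestrictBimorphism.

(** * Products in a biordered set *)

Section Biorder.
Context {E : Type} (S : IdemSystem E).
Hypothesis reg : regular_biordered_set S.

Lemma emb_idempotent (e : E) : idempotent (emb S e).
Proof. apply (rb_emb_idem reg); now exists e. Qed.

Lemma emb_mem (e : E) : mem S (emb S e).
Proof. apply emb_idempotent. Qed.

Lemma emb_square (e : E) : mul S (emb S e) (emb S e) = emb S e.
Proof. apply emb_idempotent. Qed.

(** If [he = e] then [ehe = e], which makes [eh] an idempotent. *)
Lemma omega_r_product (e h : E) : omega_r S e h ->
  exists m : E, is_product S e h m /\ R_rel S e m /\ omega_l S m h.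
Proof.
  intro H; red in H.
  pose proof (emb_mem e) as Me; pose proof (emb_mem h) as Mh.
  pose proof (rb_closed reg Me Mh) as Meh.
  assert (I : idempotent (mul S (emb S e) (emb S h))).
  { split; trivial.
    rewrite <- (rb_assoc reg Me Mh Meh), (rb_assoc reg Mh Me Mh), H.
    now rewrite (rb_assoc reg Me Me Mh), emb_square. }
  destruct (proj2 (rb_emb_idem reg _) I) as [m Em]; exists m; split; trivial.
  unfold R_rel, omega_r, omega_l; rewrite Em; repeat split.
  - now rewrite <- (rb_assoc reg Me Mh Me), H, emb_square.
  - now rewrite (rb_assoc reg Me Me Mh), emb_square.
  - now rewrite <- (rb_assoc reg Me Mh Mh), emb_square.
Qed.

Lemma omega_l_product (e h : E) : omega_l S e h ->
  exists m : E, is_product S h e m /\ L_rel S e m /\ omega_r S m h.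
Proof.
  intro H; red in H.
  pose proof (emb_mem e) as Me; pose proof (emb_mem h) as Mh.
  pose proof (rb_closed reg Mh Me) as Mhe.
  assert (I : idempotent (mul S (emb S h) (emb S e))).
  { split; trivial.
    rewrite <- (rb_assoc reg Mh Me Mhe), (rb_assoc reg Me Mh Me), H.
    now rewrite emb_square. }
  destruct (proj2 (rb_emb_idem reg _) I) as [m Em]; exists m; split; trivial.
  unfold L_rel, omega_r, omega_l; rewrite Em; repeat split.
  - now rewrite (rb_assoc reg Me Mh Me), H, emb_square.
  - now rewrite <- (rb_assoc reg Mh Me Me), emb_square.
  - now rewrite (rb_assoc reg Mh Mh Me), emb_square.
Qed.

Lemma idem_core_absorbs (e : E) (y : elt S) : idem_core (emb S e) y ->
  mem S y /\ mul S y (emb S e) = y /\ mul S (emb S e) y = y.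
Proof.
  induction 1 as [g [[M _] [H1 H2]] | g h _ [M [H1 H2]] _ [M' [H1' H2']]].
  - now repeat split.
  - pose proof (emb_mem e) as Me; repeat split.
    + now apply (rb_closed reg).
    + now rewrite <- (rb_assoc reg M M' Me), H1'.
    + now rewrite (rb_assoc reg Me M M'), H2.
Qed.

Lemma omega_r_is_product (e f : E) : omega_r S e f <-> is_product S f e e.
Proof. unfold omega_r, is_product; split; congruence. Qed.

Lemma omega_l_is_product (e f : E) : omega_l S e f <-> is_product S e f e.
Proof. unfold omega_l, is_product; split; congruence. Qed.

Lemma singular_transpose (e f g h : E) :
  singular (opposite_system S) e f g h -> singular S e g f h.
Proof. intros [k [H|H]]; exists k; [right|left]; exact H. Qed.

End Biorder.

(** * Elements of the cross-connection semigroup as morphisms *)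

Section Semigroup.
Context {C D : ConsistentCategory} (Om : CrossConnection C D).
Let S := S_Om Om.
Let E := E_Om Om.
Let G (e : E) : ConeTo (fstE e) := gamma Om (fstE e) (sndE e).
Let K (e : E) : ConeTo (sndE e) := delta Om (fstE e) (sndE e).

Lemma E_left (e : E) : M_set (Gam Om (sndE e)) (fstE e).
Proof. exact (proj2_sig e). Qed.

Lemma E_right (e : E) : M_set (Del Om (fstE e)) (sndE e).
Proof. apply cross, E_left. Qed.

Lemma gamma_apex (e : E) : G e (fstE e) = idm (fstE e).
Proof. exact (idem_cone_apex _). Qed.

Lemma delta_apex (e : E) : K e (sndE e) = idm (sndE e).
Proof. exact (idem_cone_apex _). Qed.

Lemma gamma_factor (e f : E) : subobj (sndE e) (sndE f) ->
  forall x, G e x = G f x ;; G e (fstE f).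
Proof. exact (cn_factor (Gam_local Om) (E_left e) (E_left f)). Qed.

Lemma transpose_spec (e f : E) (g : Hom (fstE e) (fstE f)) :
  represents (Del Om) g (transpose Om g (sndE e) (sndE f)).
Proof.
  exact (epsilon_spec (Hom_inhabited (sndE f) (sndE e)) (fun k => is_transpose Om g k)
    (represents_exists g (E_right e) (E_right f))).
Qed.

Lemma transpose_id (e : E) :
  transpose Om (idm (fstE e)) (sndE e) (sndE e) = idm (sndE e).
Proof.
  apply (represents_unique (E_right e) (transpose_spec (e := e) (f := e) _)).
  apply represents_id.
Qed.

Lemma transpose_comp (e f h : E) (g : Hom (fstE e) (fstE f))
    (k : Hom (fstE f) (fstE h)) :
  transpose Om (g ;; k) (sndE e) (sndE h) =
  transpose Om k (sndE f) (sndE h) ;; transpose Om g (sndE e) (sndE f).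
Proof.
  apply (represents_unique (E_right e) (transpose_spec (e := e) (f := h) _)).
  apply represents_comp; apply transpose_spec.
Qed.

(** Without this the transpose in [x_elt] would not be its own epimorphic component,
    and [x_elt_morphism] would fail. *)
Lemma transpose_epic (e f : E) (u : Hom (fstE e) (fstE f)) :
  monic u -> epic (transpose Om u (sndE e) (sndE f)).
Proof.
  intros U x g h; destruct (M_set_inhabited (Gam Om x)) as [c M].
  apply (represents_epic (Del_local Om) (E_right e) (E_right f) (transpose_spec u) U
    (b'' := c)).
  now apply cross.
Qed.

(** The element of the semigroup determined by a morphism between the first
    components of two idempotents.  Between fixed idempotents the semigroup
    multiplication is composition of these morphisms. *)
Definition morphism_elt (e f : E) (g : Hom (fstE e) (fstE f)) : elt S :=
  (cone (star (G e) (epi g)), cone (star (K f) (epi (transpose Om g (sndE e) (sndE f))))).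

Lemma morphism_elt_mul (e f h : E) (g : Hom (fstE e) (fstE f))
    (k : Hom (fstE f) (fstE h)) :
  mul S (morphism_elt g) (morphism_elt k) = morphism_elt (g ;; k).
Proof.
  unfold morphism_elt; rewrite (transpose_comp (e := e) (f := f) (h := h)).
  apply injective_projections; apply cone_mul_star; [apply gamma_apex | apply delta_apex].
Qed.

Lemma morphism_elt_inj (e f : E) (g k : Hom (fstE e) (fstE f)) :
  morphism_elt g = morphism_elt k -> g = k.
Proof. intro H; exact (star_epi_inj (f_equal fst H)). Qed.

Lemma morphism_elt_id (e : E) : emb S e = morphism_elt (idm (fstE e)).
Proof.
  unfold morphism_elt; rewrite transpose_id.
  apply injective_projections; simpl; symmetry; apply star_epi_id.
Qed.

Lemma morphism_elt_linked (e f : E) (g : Hom (fstE e) (fstE f)) :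
  mem S (morphism_elt g).
Proof.
  exists (fstE f), (sndE e); split.
  - exact (dual_value g (E_left e)).
  - exists (fstE e), (sndE f), g; repeat split.
    + apply E_left.
    + apply E_right.
Qed.

Definition underlying (u : Arrow (I_Om Om)) : Hom (fstE (src u)) (fstE (tgt u)) :=
  proj1_sig (mor u).

Lemma underlying_bimorphism (u : Arrow (I_Om Om)) : bimorphism (underlying u).
Proof. exact (proj2_sig (mor u)). Qed.

Lemma x_elt_morphism (u : Arrow (I_Om Om)) :
  x_elt u = morphism_elt (underlying u).
Proof.
  destruct (underlying_bimorphism u) as [U1 U2].
  apply injective_projections; simpl; symmetry; apply star_epic; trivial.
  now apply transpose_epic.
Qed.

(** * The biorder *)

(** The product fixes the first cone exactly when the apex is a subobject; the
    second cones then agree because the functors on [D] are nested. *)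
Lemma omega_l_iff (e f : E) : omega_l S e f <-> subobj (fstE e) (fstE f).
Proof.
  split.
  - intro H; exact (cone_mul_sub_inv (f_equal fst H)).
  - intro H; apply injective_projections; simpl.
    + apply (cone_mul_sub _ (gamma_apex f) H).
    + exact (cn_absorb (Del_local Om) (E_right e) (E_right f) H).
Qed.

Lemma omega_r_iff (e f : E) : omega_r S e f <-> subobj (sndE e) (sndE f).
Proof.
  split.
  - intro H; exact (cone_mul_sub_inv (f_equal snd H)).
  - intro H; apply injective_projections; simpl.
    + exact (cn_absorb (Gam_local Om) (E_left e) (E_left f) H).
    + apply (cone_mul_sub _ (delta_apex f) H).
Qed.

Lemma omega_iff (e f : E) : omega S e f <-> subE e f.
Proof.
  unfold omega, subE; now rewrite omega_l_iff, omega_r_iff.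
Qed.

Lemma R_rel_iff (e f : E) : R_rel S e f <-> sndE e = sndE f.
Proof.
  unfold R_rel; rewrite !omega_r_iff; split.
  - intros [H1 H2]; now apply (incl_strict (cc_subobjects (con_ax D))).
  - intros ->; split; apply sub_refl.
Qed.

Lemma L_rel_iff (e f : E) : L_rel S e f <-> fstE e = fstE f.
Proof.
  unfold L_rel; rewrite !omega_l_iff; split.
  - intros [H1 H2]; now apply (incl_strict (cc_subobjects (con_ax C))).
  - intros ->; split; apply sub_refl.
Qed.

Lemma subE_refl (e : E) : subE e e.
Proof. split; apply sub_refl. Qed.

Lemma E_eq (e f : E) : fstE e = fstE f -> sndE e = sndE f -> e = f.
Proof.
  intros H1 H2; apply sig_eq; apply injective_projections; assumption.
Qed.

Lemma subE_antisym (e f : E) : subE e f -> subE f e -> e = f.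
Proof.
  intros [H1 H2] [H3 H4]; apply E_eq; apply incl_strict; trivial; apply con_ax.
Qed.

(** The bound [d] is essential: the functor from [D] to the dual need not be injective
    on objects, only on each ideal. *)
Lemma E_determined (e f : E) (d : D) :
  subobj (sndE e) d -> subobj (sndE f) d -> cone (G e) = cone (G f) -> e = f.
Proof.
  destruct e as [[c d1] M1], f as [[c' d2] M2]; unfold G, fstE, sndE; simpl.
  intros S1 S2 H.
  assert (X : c = c') by exact (f_equal (@apex C) H); subst c'.
  apply cone_inj in H; apply E_eq; trivial; unfold sndE; simpl.
  apply (ideal_determined (Gam_local Om) S1 S2 M1 M2); intro x.
  exact (f_equal (fun z : ConeTo c => z x) H).
Qed.

Section Regular.
Hypothesis reg : regular_biordered_set S.

(** The element of the endomorphism [q ;; i] is idempotent, hence comes from an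
    idempotent of the semigroup; that one has the same first cone as [e1] and
    lies in the same ideal. *)
Lemma emb_below (e1 e : E) (i : Hom (fstE e1) (fstE e)) :
  subE e1 e -> incl i -> emb S e1 = morphism_elt (e := e) (f := e) (G e1 (fstE e) ;; i).
Proof.
  intros [_ SD] I.
  set (q := G e1 (fstE e)); set (x := morphism_elt (e := e) (f := e) (q ;; i)).
  assert (Q : i ;; q = idm _) by (unfold q; rewrite (leg_incl (G e1) I); apply gamma_apex).
  assert (X : idempotent (B := S) x).
  { split; [apply morphism_elt_linked|]; unfold x; rewrite morphism_elt_mul; f_equal.
    now rewrite <- comp_assoc, (comp_assoc i), Q, comp_id_l. }
  destruct (proj2 (rb_emb_idem reg x) X) as [m M]; rewrite <- M; f_equal.
  assert (Mr : omega_r S m e).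
  { red; rewrite M; unfold x; rewrite morphism_elt_id, morphism_elt_mul.
    now rewrite comp_id_l. }
  apply omega_r_iff in Mr.
  apply (E_determined SD Mr).
  apply (f_equal fst) in M; simpl in M.
  assert (Y : cone (G m) = cone (star (G e) q)).
  { etransitivity; [exact M|]; apply (star_epi (G e) (split_epic Q) I eq_refl). }
  rewrite Y; f_equal; apply ConeTo_ext; intro z; exact (gamma_factor SD z).
Qed.

(** * Restrictions and the connecting isomorphism *)

(** The order on morphisms, freed of images and of the connecting isomorphism:
    [u1] commutes with [u] through the inclusions and through the retractions of
    the two idempotents. *)
Definition restricts (u1 u : Arrow (I_Om Om)) : Prop :=
  subE (src u1) (src u) /\ subE (tgt u1) (tgt u) /\
  exists (i : Hom (fstE (src u1)) (fstE (src u)))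
    (j : Hom (fstE (tgt u1)) (fstE (tgt u))),
    incl i /\ incl j /\
    i ;; underlying u = underlying u1 ;; j /\
    G (src u1) (fstE (src u)) ;; underlying u1 =
      underlying u ;; G (tgt u1) (fstE (tgt u)).

(** The subobject of the codomain carries a retraction, and [ideal_retract] finds the
    second component that makes it an idempotent with this retraction as a leg. *)
Lemma restriction_exists (u : Arrow (I_Om Om)) (e : E) : subE e (src u) ->
  exists (f : I_Om Om) (w : @Hom (I_Om Om) e f), restricts (arrow w) u.
Proof.
  destruct u as [a b [u U]]; simpl; intros [[i I] SD].
  assert (Q : i ;; G e (fstE a) = idm _) by (rewrite (leg_incl (G e) I); apply gamma_apex).
  destruct (bimorphism_restrict U I Q) as (c1 & w & j & p & W & J & P & H1 & H2).
  destruct (ideal_retract (Gam_local Om) (E_left b) J P) as (d1 & S1 & M1 & L).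
  pose (f := exist (fun z : C * D => M_set (Gam Om (snd z)) (fst z)) (c1, d1) M1 : E).
  exists f, (exist (fun w : Hom (fstE e) (fstE f) => bimorphism w) w W).
  split; [|split].
  - split; [now exists i | trivial].
  - split; [now exists j | trivial].
  - exists i, j; repeat split; trivial; simpl in *.
    etransitivity; [exact H2|]; f_equal; symmetry; etransitivity; [apply (L (fstE b))|].
    rewrite <- (comp_id_l p) at 2; f_equal; exact (gamma_apex b).
Qed.

Lemma corestriction_exists (u : Arrow (I_Om Om)) (f : E) : subE f (tgt u) ->
  exists (e : I_Om Om) (w : @Hom (I_Om Om) e f), restricts (arrow w) u.
Proof.
  destruct u as [a b [u U]]; simpl; intros [[j J] SD].
  assert (P : j ;; G f (fstE b) = idm _) by (rewrite (leg_incl (G f) J); apply gamma_apex).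
  destruct (bimorphism_corestrict U J P) as (c1 & w & i & q & W & I & Q & H1 & H2).
  destruct (ideal_retract (Gam_local Om) (E_left a) I Q) as (d1 & S1 & M1 & L).
  pose (e := exist (fun z : C * D => M_set (Gam Om (snd z)) (fst z)) (c1, d1) M1 : E).
  exists e, (exist (fun w : Hom (fstE e) (fstE f) => bimorphism w) w W).
  split; [|split].
  - split; [now exists i | trivial].
  - split; [now exists j | trivial].
  - exists i, j; repeat split; trivial; simpl in *.
    etransitivity; [|exact H2]; f_equal; etransitivity; [apply (L (fstE a))|].
    rewrite <- (comp_id_l q) at 2; f_equal; exact (gamma_apex a).
Qed.

(** Conjugation by [u] is a relation, since [u] need not be invertible; [g] and [h]
    range over endomorphisms, so that products can be taken. *)
Definition conjugate (u : Arrow (I_Om Om)) (y z : elt S) : Prop :=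
  exists (g : Hom (fstE (src u)) (fstE (src u))) (h : Hom (fstE (tgt u)) (fstE (tgt u))),
    y = morphism_elt g /\ z = morphism_elt h /\ g ;; underlying u = underlying u ;; h.

Lemma conjugate_emb (u1 u : Arrow (I_Om Om)) : restricts u1 u ->
  conjugate u (emb S (src u1)) (emb S (tgt u1)).
Proof.
  intros (S1 & S2 & i & j & I & J & H1 & H2).
  exists (G (src u1) (fstE (src u)) ;; i), (G (tgt u1) (fstE (tgt u)) ;; j).
  split; [exact (emb_below S1 I) | split; [exact (emb_below S2 J) |]].
  now rewrite <- comp_assoc, H1, !comp_assoc, H2.
Qed.

Lemma conjugate_mul (u : Arrow (I_Om Om)) (y z y' z' : elt S) :
  conjugate u y z -> conjugate u y' z' -> conjugate u (mul S y y') (mul S z z').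
Proof.
  intros (g & h & -> & -> & H) (g' & h' & -> & -> & H').
  exists (g ;; g'), (h ;; h'); rewrite !morphism_elt_mul; repeat split.
  now rewrite <- comp_assoc, H', comp_assoc, H, comp_assoc.
Qed.

Lemma conjugate_fun (u : Arrow (I_Om Om)) (y z z' : elt S) :
  conjugate u y z -> conjugate u y z' -> z = z'.
Proof.
  intros (g & h & Y & -> & H) (g' & h' & Y' & -> & H').
  rewrite Y in Y'; apply morphism_elt_inj in Y'; subst g'; f_equal.
  apply (proj2 (underlying_bimorphism u)); congruence.
Qed.

Lemma conjugate_inj (u : Arrow (I_Om Om)) (y y' z : elt S) :
  conjugate u y z -> conjugate u y' z -> y = y'.
Proof.
  intros (g & h & -> & Z & H) (g' & h' & -> & Z' & H').
  rewrite Z in Z'; apply morphism_elt_inj in Z'; subst h'; f_equal.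
  apply (proj1 (underlying_bimorphism u)); congruence.
Qed.

(** The converse of [conjugate_commutes] for idempotents, as an equation in [C]. *)
Lemma conjugate_of_commutes (u : Arrow (I_Om Om)) (e1 f1 : E)
    (i : Hom (fstE e1) (fstE (src u))) (j : Hom (fstE f1) (fstE (tgt u))) :
  subE e1 (src u) -> subE f1 (tgt u) -> incl i -> incl j ->
  mul S (emb S e1) (x_elt u) = mul S (x_elt u) (emb S f1) ->
  G e1 (fstE (src u)) ;; i ;; underlying u =
  underlying u ;; (G f1 (fstE (tgt u)) ;; j).
Proof.
  intros S1 S2 I J H.
  rewrite (emb_below S1 I), (emb_below S2 J), x_elt_morphism in H.
  rewrite !morphism_elt_mul in H; exact (morphism_elt_inj H).
Qed.

Lemma conjugate_commutes (u : Arrow (I_Om Om)) (y z : elt S) :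
  conjugate u y z -> mul S y (x_elt u) = mul S (x_elt u) z.
Proof.
  intros (g & h & -> & -> & H).
  now rewrite x_elt_morphism, !morphism_elt_mul, H.
Qed.

Lemma idem_core_below (e : E) (g : elt S) :
  idempotent (B := S) g -> mul S g (emb S e) = g -> mul S (emb S e) g = g ->
  exists e1 : E, emb S e1 = g /\ subE e1 e.
Proof.
  intros I H1 H2; destruct (proj2 (rb_emb_idem reg g) I) as [e1 <-].
  exists e1; split; trivial; apply omega_iff; now split.
Qed.

Lemma idem_core_emb (e1 e : E) : subE e1 e -> idem_core (emb S e) (emb S e1).
Proof.
  intro H; apply omega_iff in H; destruct H as [H1 H2]; apply gen_base; repeat split;
    trivial; apply (emb_idempotent reg).
Qed.

Lemma emb_idem_core (e1 e : E) : idem_core (emb S e) (emb S e1) -> subE e1 e.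
Proof. intro H; apply omega_iff; split; apply (idem_core_absorbs reg H). Qed.

(** Induction on words in the idempotents below the source: a letter is conjugated by
    restricting [u] to it. *)
Lemma conjugate_exists (u : Arrow (I_Om Om)) (y : elt S) :
  idem_core (emb S (src u)) y ->
  exists z, idem_core (emb S (tgt u)) z /\ conjugate u y z.
Proof.
  induction 1 as [g [I [H1 H2]] | g h _ [g' [Ig Cg]] _ [h' [Ih Ch]]].
  - destruct (idem_core_below I H1 H2) as (e & <- & Se).
    destruct (restriction_exists Se) as (f & w & W); exists (emb S f); split.
    + apply idem_core_emb; apply W.
    + exact (conjugate_emb W).
  - exists (mul S g' h'); split; [now apply gen_mul | now apply conjugate_mul].
Qed.

Lemma conjugate_exists_inv (u : Arrow (I_Om Om)) (z : elt S) :
  idem_core (emb S (tgt u)) z ->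
  exists y, idem_core (emb S (src u)) y /\ conjugate u y z.
Proof.
  induction 1 as [g [I [H1 H2]] | g h _ [g' [Ig Cg]] _ [h' [Ih Ch]]].
  - destruct (idem_core_below I H1 H2) as (f & <- & Sf).
    destruct (corestriction_exists Sf) as (e & w & W); exists (emb S e); split.
    + apply idem_core_emb; apply W.
    + exact (conjugate_emb W).
  - exists (mul S g' h'); split; [now apply gen_mul | now apply conjugate_mul].
Qed.

Lemma connecting_exists (u : Arrow (I_Om Om)) :
  exists v, connecting_iso u v /\
    forall y, idem_core (emb S (src u)) y -> conjugate u y (v y).
Proof.
  pose (v := fun y => epsilon (inhabits y)
    (fun z => idem_core (emb S (tgt u)) z /\ conjugate u y z)).
  assert (V : forall y, idem_core (emb S (src u)) y ->
    idem_core (emb S (tgt u)) (v y) /\ conjugate u y (v y)).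
  { intros y H; exact (epsilon_spec (inhabits y) _ (conjugate_exists H)). }
  exists v; split; [|intros y H; apply (V y H)]; split.
  - intros y H; apply (V y H).
  - intros y z Y Z H; apply (@conjugate_inj u y z (v z)); [rewrite <- H|]; now apply V.
  - intros z Z; destruct (conjugate_exists_inv Z) as (y & Y & H); exists y; split; trivial.
    apply (@conjugate_fun u y); trivial; now apply V.
  - intros y z Y Z; apply (@conjugate_fun u (mul S y z)).
    + apply V; now apply gen_mul.
    + apply conjugate_mul; now apply V.
  - intros y Y; now apply conjugate_commutes, V.
Qed.

(** From left to right, the arbitrary connecting map given by the order must send
    [src u1] to an idempotent that commutes with [x_elt u]; this is the square of
    retractions, up to a monic inclusion. *)
Lemma le_Om_iff (u1 u : Arrow (I_Om Om)) : le_Om u1 u <-> restricts u1 u.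
Proof.
  split.
  - intros (S1 & (i & I & H) & v & V & T).
    assert (S2 : subE (tgt u1) (tgt u)).
    { apply emb_idem_core; fold S in T; rewrite T; apply (cn_range V).
      now apply idem_core_emb. }
    destruct (proj1 S2) as [j J].
    assert (H1 : i ;; underlying u = underlying u1 ;; j).
    { apply arrow_inj in H; exact (epi_factor_by (eq_sym H) J). }
    split; [|split]; trivial; exists i, j; repeat split; trivial.
    pose proof (cn_conn V (idem_core_emb S1)) as N; fold S in N, T; rewrite <- T in N.
    apply (conjugate_of_commutes S1 S2 I J) in N.
    apply (incl_monic (cc_subobjects (con_ax C)) J).
    rewrite <- comp_assoc, <- H1, comp_assoc; etransitivity; [exact N|].
    apply comp_assoc.
  - intro R; assert (R' := R); destruct R' as (S1 & S2 & i & j & I & J & H1 & H2).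
    split; trivial; split.
    + exists i; split; trivial.
      pose proof (epi_unique (proj2 (proj2_sig (mor u1))) J H1) as H.
      symmetry; exact (f_equal (fun z : {m : C & Hom (fstE (src u1)) m} =>
        arrow (projT2 z)) H).
    + destruct (connecting_exists u) as (v & V & N); exists v; split; trivial.
      apply (@conjugate_fun u (emb S (src u1))); [now apply conjugate_emb|].
      apply N; now apply idem_core_emb.
Qed.

(** * The order on morphisms *)

Lemma leg_incl_sub (e f : E) (i : Hom (fstE e) (fstE f)) : incl i -> G f (fstE e) = i.
Proof. apply leg_sub, gamma_apex. Qed.

Lemma restricts_refl (u : Arrow (I_Om Om)) : restricts u u.
Proof.
  split; [apply subE_refl | split; [apply subE_refl|]].
  exists (idm _), (idm _); rewrite !gamma_apex, !comp_id_l, !comp_id_r.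
  repeat split; apply (incl_id (cc_subobjects (con_ax C))).
Qed.

Lemma restricts_trans (u v w : Arrow (I_Om Om)) :
  restricts u v -> restricts v w -> restricts u w.
Proof.
  intros (S1 & S2 & i & j & I & J & H1 & H2) (S1' & S2' & i' & j' & I' & J' & H1' & H2').
  split; [split; eapply sub_trans; [apply S1|apply S1'|apply S1|apply S1']|].
  split; [split; eapply sub_trans; [apply S2|apply S2'|apply S2|apply S2']|].
  exists (i ;; i'), (j ;; j'); split; [|split; [|split]].
  - now apply (incl_comp (cc_subobjects (con_ax C))).
  - now apply (incl_comp (cc_subobjects (con_ax C))).
  - now rewrite <- comp_assoc, H1', comp_assoc, H1, comp_assoc.
  - rewrite (gamma_factor (proj2 S1) (fstE (src w))), <- comp_assoc, H2.
    now rewrite comp_assoc, H2', <- comp_assoc, <- (gamma_factor (proj2 S2)).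
Qed.

Lemma restricts_eq (u v w : Arrow (I_Om Om)) :
  restricts u w -> restricts v w -> src u = src v -> tgt u = tgt v -> u = v.
Proof.
  destruct u as [e f [u U]], v as [e' f' [v V]]; simpl.
  intros (_ & _ & i & j & I & J & H1 & _) (_ & _ & i' & j' & I' & J' & H1' & _) X Y.
  subst e' f'; unfold underlying in *; simpl in *.
  rewrite (incl_unique (cc_subobjects (con_ax C)) I' I) in H1'.
  rewrite (incl_unique (cc_subobjects (con_ax C)) J' J) in H1'.
  do 2 f_equal; apply sig_eq; simpl.
  apply (incl_monic (cc_subobjects (con_ax C)) J); congruence.
Qed.

Lemma restricts_tgt (u v w : Arrow (I_Om Om)) :
  restricts u w -> restricts v w -> src u = src v -> tgt u = tgt v.
Proof.
  intros H1 H2 X; apply (rb_emb_inj reg), (@conjugate_fun w (emb S (src u))).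
  - now apply conjugate_emb.
  - rewrite X; now apply conjugate_emb.
Qed.

Lemma restricts_src (u v w : Arrow (I_Om Om)) :
  restricts u w -> restricts v w -> tgt u = tgt v -> src u = src v.
Proof.
  intros H1 H2 X; apply (rb_emb_inj reg), (@conjugate_inj w _ _ (emb S (tgt u))).
  - now apply conjugate_emb.
  - rewrite X; now apply conjugate_emb.
Qed.

Lemma restricts_id (e f : I_Om Om) :
  restricts (arrow (idm e)) (arrow (idm f)) <-> subE e f.
Proof.
  split; [now intros [H _] | intro H].
  split; [trivial | split; [trivial|]]; destruct (proj1 H) as [i I].
  exists i, i; unfold underlying; simpl; rewrite !comp_id_l, !comp_id_r; repeat split; trivial.
Qed.

Lemma restricts_comp (a b c a' b' c' : I_Om Om) (u : Hom a b) (v : Hom b c)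
    (x : Hom a' b') (y : Hom b' c') :
  restricts (arrow u) (arrow x) -> restricts (arrow v) (arrow y) ->
  restricts (arrow (u ;; v)) (arrow (x ;; y)).
Proof.
  intros (S1 & S2 & i & j & I & J & H1 & H2) (S1' & S2' & i' & j' & I' & J' & H1' & H2').
  unfold underlying in *; simpl in *.
  rewrite (incl_unique (cc_subobjects (con_ax C)) I' J) in H1'.
  split; [trivial | split; [trivial|]]; exists i, j'; unfold underlying; simpl.
  split; [trivial | split; [trivial | split]].
  - now rewrite comp_assoc, H1, <- comp_assoc, H1', comp_assoc.
  - now rewrite comp_assoc, H2, <- comp_assoc, H2', comp_assoc.
Qed.

Lemma I_Om_bimorphism (a b : I_Om Om) (x : Hom a b) : bimorphism x.
Proof.
  destruct x as [x [X1 X2]]; split; intros c g h H;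
    apply (f_equal (@proj1_sig _ _)) in H; apply sig_eq; simpl in H.
  - now apply X1.
  - now apply X2.
Qed.

Lemma I_Om_ordered : ordered_cancellative_category (le_Om (Om := Om)).
Proof.
  split.
  - intro x; apply le_Om_iff, restricts_refl.
  - intros x y z; rewrite !le_Om_iff; apply restricts_trans.
  - intros x y; rewrite !le_Om_iff; intros H1 H2.
    apply (restricts_eq H1 (restricts_refl y)); apply subE_antisym;
      first [apply H1 | apply H2].
  - intros a b x; apply I_Om_bimorphism.
  - intros a b c a' b' c' u v x y; rewrite !le_Om_iff; apply restricts_comp.
  - intros x y; rewrite !le_Om_iff, !restricts_id; intros (H1 & H2 & _); now split.
  - intros x e; rewrite le_Om_iff, restricts_id; intro H.
    destruct (restriction_exists H) as (f & w & R); exists (arrow w); split.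
    + split; [now apply le_Om_iff | reflexivity].
    + intros y [L Y]; apply le_Om_iff in L; symmetry in Y.
      exact (restricts_eq R L Y (restricts_tgt R L Y)).
  - intros x f; rewrite le_Om_iff, restricts_id; intro H.
    destruct (corestriction_exists H) as (e & w & R); exists (arrow w); split.
    + split; [now apply le_Om_iff | reflexivity].
    + intros y [L Y]; apply le_Om_iff in L; symmetry in Y.
      exact (restricts_eq R L (restricts_src R L Y) Y).
Qed.

(** * Distinguished morphisms *)

Definition related (e f : E) : Prop := R_rel S e f \/ L_rel S e f.

Lemma related_sym (e f : E) : related e f -> related f e.
Proof. intros [[H1 H2]|[H1 H2]]; [left|right]; now split. Qed.

Lemma leg_comp_R (e f g : E) : subobj (sndE g) (sndE f) ->
  G f (fstE e) ;; G g (fstE f) = G g (fstE e).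
Proof. intro H; symmetry; exact (gamma_factor H _). Qed.

Lemma leg_comp_L (e f g : E) : subobj (fstE e) (fstE f) ->
  G f (fstE e) ;; G g (fstE f) = G g (fstE e).
Proof. intros [i I]; rewrite (leg_incl_sub I); exact (leg_incl (G g) I). Qed.

Lemma related_comp (e f g : E) :
  (R_rel S e f /\ R_rel S f g) \/ (L_rel S e f /\ L_rel S f g) ->
  G f (fstE e) ;; G g (fstE f) = G g (fstE e).
Proof.
  intros [[_ [_ H]]|[[H _] _]].
  - apply leg_comp_R; now apply omega_r_iff.
  - apply leg_comp_L; now apply omega_l_iff.
Qed.

Lemma related_inverse (e f : E) : related e f -> G f (fstE e) ;; G e (fstE f) = idm _.
Proof.
  intros [[H1 H2]|[H1 H2]]; rewrite related_comp; try apply gamma_apex;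
    [left | right]; now repeat split.
Qed.

Lemma related_bimorphism (e f : E) : related e f -> bimorphism (G f (fstE e)).
Proof.
  intro H; apply iso_bimorphism; exists (G e (fstE f)); split.
  - now apply related_inverse.
  - apply related_inverse; now apply related_sym.
Qed.

Lemma dist_exists (e f : I_Om Om) : related e f ->
  exists h : Hom e f, dist_Om h.
Proof.
  intro H; exists (exist _ (G f (fstE e)) (related_bimorphism H)); now split.
Qed.

Lemma product_right (e k m : E) : omega_r S e k ->
  emb S m = mul S (emb S e) (emb S k) ->
  R_rel S e m /\ omega_l S m k /\
  cone (G m) = cone (star (G e) (epi (G k (fstE e)))).
Proof.
  intros H M; destruct (omega_r_product reg H) as (m' & M' & H1 & H2).
  red in M'; rewrite <- M in M'; apply (rb_emb_inj reg) in M'; subst m'.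
  repeat split; try apply H1; trivial; exact (f_equal fst M).
Qed.

(** The first component of the product is the image of a leg of the larger cone. *)
Lemma product_right_leg (e k m : E) (l : Hom (fstE m) (fstE k)) : omega_r S e k ->
  emb S m = mul S (emb S e) (emb S k) -> incl l ->
  fstE m = im (G k (fstE e)) /\ G m (fstE e) ;; l = G k (fstE e).
Proof.
  intros H M L; destruct (product_right H M) as (_ & _ & X); split.
  - exact (f_equal (@apex C) X).
  - symmetry; exact (epi_factor_by (eq_sym (cone_leg_star (gamma_apex e) X)) L).
Qed.

(** The inclusion [b] only identifies the equal objects [fstE e] and [fstE m]. *)
Lemma product_left (e k m : E) : omega_l S e k ->
  emb S m = mul S (emb S k) (emb S e) ->
  L_rel S e m /\ omega_r S m k /\
  forall b : Hom (fstE e) (fstE m), incl b ->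
  forall x, G m x = G k x ;; G e (fstE k) ;; b.
Proof.
  intros H M; destruct (omega_l_product reg H) as (m' & M' & H1 & H2).
  red in M'; rewrite <- M in M'; apply (rb_emb_inj reg) in M'; subst m'.
  split; [trivial | split; [trivial | intros b B]].
  apply omega_l_iff in H; destruct H as [i I].
  assert (Q : i ;; G e (fstE k) = idm _) by (rewrite (leg_incl (G e) I); apply gamma_apex).
  assert (X : cone (G m) = cone (star (G k) (epi (G e (fstE k))))) by exact (f_equal fst M).
  rewrite (star_epic _ (split_epic Q)) in X.
  exact (cone_eq_incl X B).
Qed.

(** Restricting an isomorphism [G h] between the first components of two
    idempotents with the same second component gives a morphism of the same kind:
    its target has the cone of [e] moved along it, so the same second component. *)
Lemma restrict_R (g h e f : I_Om Om) (x : Hom g h) (w : @Hom (I_Om Om) e f) :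
  R_rel S g h -> proj1_sig x = G h (fstE g) -> restricts (arrow w) (arrow x) ->
  R_rel S e f /\ proj1_sig w = G f (fstE e) /\ emb S f = mul S (emb S e) (emb S h).
Proof.
  intros R X (S1 & S2 & i & j & I & J & H1 & H2).
  unfold underlying in *; simpl in *; rewrite X in H1, H2; clear X.
  destruct w as [w W]; simpl in *.
  assert (Rgh : related g h) by now left.
  assert (Dgh : sndE g = sndE h) by now apply R_rel_iff.
  assert (Se : subobj (sndE e) (sndE h)) by (rewrite <- Dgh; apply S1).
  (* The leg of [e] at the target inverts [w], since [x] is invertible. *)
  assert (W2 : G e (fstE f) ;; w = idm _).
  { rewrite <- (leg_incl (G e) J), (gamma_factor (proj2 S1) (fstE h)), <- !comp_assoc, H2.
    rewrite (comp_assoc (G g (fstE h))), (related_inverse (related_sym Rgh)), comp_id_l.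
    rewrite (leg_incl (G f) J); apply gamma_apex. }
  assert (W1 : w ;; G e (fstE f) = idm _).
  { rewrite <- (leg_incl (G e) J), (gamma_factor (proj2 S1) (fstE h)).
    rewrite !comp_assoc, <- H1, <- (comp_assoc i), (related_inverse Rgh), comp_id_r.
    rewrite (leg_incl (G e) I); apply gamma_apex. }
  destruct (cn_move (Gam_local Om) (E_left e) W2 W1) as [M L].
  pose (f' := exist (fun z : C * D => M_set (Gam Om (snd z)) (fst z))
    (fstE f, sndE e) M : E).
  assert (Cf : cone (G f') = cone (star (G e) w)).
  { f_equal; apply ConeTo_ext; intro z; exact (L z). }
  assert (F : f' = f).
  { apply (E_determined (d := sndE h)); [exact Se | apply S2 |].
    rewrite Cf; f_equal; apply ConeTo_ext; intro z; simpl.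
    rewrite (gamma_factor (proj2 S2) z).
    assert (Dhg : subobj (sndE h) (sndE g)) by (rewrite Dgh; apply sub_refl).
    rewrite (gamma_factor Dhg z), <- comp_assoc, <- H2, comp_assoc.
    now rewrite <- (gamma_factor (proj2 S1)). }
  assert (Re : R_rel S e f) by (apply R_rel_iff; rewrite <- F; reflexivity).
  split; [trivial | split].
  - assert (Dhh : subobj (sndE f) (sndE h)) by apply S2.
    rewrite <- (leg_incl (G f) I), (gamma_factor Dhh (fstE g)), <- H2, comp_assoc.
    now rewrite (leg_incl (G e) I), gamma_apex, comp_id_l.
  - assert (O : omega_r S e h) by now apply omega_r_iff.
    destruct (omega_r_product reg O) as (m & M1 & M2 & M3).
    enough (Z : f = m) by (rewrite Z; exact M1).
    destruct (product_right O M1) as (_ & _ & Cm).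
    apply R_rel_iff in M2; apply R_rel_iff in Re.
    apply (E_determined (d := sndE e)); [rewrite Re; apply sub_refl | rewrite M2; apply sub_refl |].
    rewrite Cm, <- F, Cf; symmetry.
    apply (star_epi (G e) (proj2 W) J).
    now rewrite <- H1, (leg_incl (G h) I).
Qed.

(** Here [x] and [y] only identify equal objects, and the restriction of [x] to [e] is
    found as the product [h e] rather than through the image functor. *)
Lemma restrict_L (g h e m : E) (x : Hom (fstE g) (fstE h)) (y : Hom (fstE e) (fstE m))
    (i : Hom (fstE e) (fstE g)) (j : Hom (fstE m) (fstE h)) :
  L_rel S g h -> x = G h (fstE g) -> subE e g -> y = G m (fstE e) ->
  emb S m = mul S (emb S h) (emb S e) -> incl i -> incl j ->
  i ;; x = y ;; j /\ G e (fstE g) ;; y = x ;; G m (fstE h).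
Proof.
  intros R X S1 Y M I J.
  apply L_rel_iff in R.
  assert (Sgh : subobj (fstE g) (fstE h)) by (rewrite R; apply sub_refl).
  assert (Seh : subobj (fstE e) (fstE h)) by (rewrite <- R; apply S1).
  destruct (product_left (proj2 (omega_l_iff e h) Seh) M) as (Lm & _ & T).
  assert (Sem : subobj (fstE e) (fstE m)).
  { apply L_rel_iff in Lm; rewrite Lm; apply sub_refl. }
  destruct Sgh as [b B], Sem as [c K'].
  rewrite (leg_incl_sub B) in X; rewrite (leg_incl_sub K') in Y; subst x y.
  split.
  - apply (incl_unique (cc_subobjects (con_ax C)));
      now apply (incl_comp (cc_subobjects (con_ax C))).
  - rewrite (T c K'), (gamma_apex h), comp_id_l, comp_assoc; f_equal.
    symmetry; exact (leg_incl (G e) B).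
Qed.

Lemma I_Om_distinguished :
  distinguished_morphisms (le_Om (Om := Om)) S (dist_Om (Om := Om)).
Proof.
  split.
  - intros e f H; destruct (dist_exists H) as [h Hh]; exists h; split; trivial.
    intros k [_ Hk]; apply sig_eq; destruct Hh as [_ Hh]; congruence.
  - intros e f h H; apply H.
  - intro e; split; [left; apply R_rel_iff; reflexivity | symmetry; apply gamma_apex].
  - intros e f g h k H [_ Hh] [_ Hk]; split.
    + destruct H as [[H1 H2]|[H1 H2]]; [left; apply R_rel_iff | right; apply L_rel_iff].
      * apply R_rel_iff in H1; apply R_rel_iff in H2; congruence.
      * apply L_rel_iff in H1; apply L_rel_iff in H2; congruence.
    + simpl; rewrite Hh, Hk; apply (related_comp H).
  - intros g h e x [R X] O; apply omega_iff in O.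
    pose proof (emb_mem reg e) as Me; pose proof (emb_mem reg h) as Mh.
    destruct R as [R|R].
    + destruct (restriction_exists (u := arrow x) O) as (f & w & Hw).
      destruct (restrict_R R X Hw) as (Re & We & Fe).
      exists f, w; split; [|split].
      * assert (Or : omega_r S e h).
        { apply omega_r_iff; apply R_rel_iff in R; rewrite <- R; apply O. }
        etransitivity; [exact Fe|].
        exact (f_equal (fun z => mul S z (emb S h)) (eq_sym Or)).
      * split; [now left | exact We].
      * now apply le_Om_iff.
    + assert (Oh : omega_l S e h).
      { apply omega_l_iff; apply L_rel_iff in R; rewrite <- R; apply O. }
      destruct (omega_l_product reg Oh) as (m & M & L & Or).
      destruct (dist_exists (e := e) (f := m) (or_intror L)) as [y Y].
      exists m, y; split; [|split]; trivial.
      * etransitivity; [|exact (rb_assoc reg Mh Me Mh)]; rewrite Oh; exact M.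
      * apply le_Om_iff.
        assert (Sm : subE m h).
        { split; [|now apply omega_r_iff].
          apply L_rel_iff in L; rewrite <- L; now apply omega_l_iff. }
        destruct (proj1 O) as [i I], (proj1 Sm) as [j J].
        destruct (restrict_L R X O (proj2 Y) M I J) as [H1 H2].
        split; [trivial | split; [trivial|]]; exists i, j; now repeat split.
Qed.

(** * Compatibility with the biorder *)

(** Both comparison morphisms are an inclusion followed by a retraction, and
    [restricts] lets [x] slide past each. *)
Lemma restricts_leg (y1 y2 x : Arrow (I_Om Om)) :
  restricts y1 x -> restricts y2 x ->
  G (src y2) (fstE (src y1)) ;; underlying y2 =
  underlying y1 ;; G (tgt y2) (fstE (tgt y1)).
Proof.
  intros (_ & _ & i & j & I & J & H1 & _) (_ & _ & _ & _ & _ & _ & _ & H2).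
  rewrite <- (leg_incl (G (src y2)) I), <- (leg_incl (G (tgt y2)) J).
  now rewrite <- comp_assoc, H2, !comp_assoc, H1.
Qed.

(** Conjugation by [x] is multiplicative and injective, so products of idempotents
    below the source and below the target correspond. *)
Lemma restricts_product_iff (y1 y2 y12 x : Arrow (I_Om Om)) :
  restricts y1 x -> restricts y2 x -> restricts y12 x ->
  is_product S (src y1) (src y2) (src y12) <-> is_product S (tgt y1) (tgt y2) (tgt y12).
Proof.
  intros H1 H2 H12; apply conjugate_emb in H1, H2, H12.
  pose proof (conjugate_mul H1 H2) as H; unfold is_product; split; intro X.
  - rewrite X in H12; exact (conjugate_fun H12 H).
  - rewrite X in H12; exact (conjugate_inj H12 H).
Qed.

Lemma product_right_below (e1 e2 m e : E) : subE e1 e -> subE e2 e -> omega_r S e1 e2 ->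
  is_product S e1 e2 m -> subE m e.
Proof.
  intros S1 S2 H M; destruct (product_right H M) as (R & L & _).
  apply R_rel_iff in R; apply omega_l_iff in L; split.
  - exact (sub_trans L (proj1 S2)).
  - rewrite <- R; apply S1.
Qed.

Lemma product_left_below (e1 e2 m e : E) : subE e1 e -> subE e2 e -> omega_l S e1 e2 ->
  is_product S e2 e1 m -> subE m e.
Proof.
  intros S1 S2 H M; destruct (product_left H M) as (L & R & _).
  apply L_rel_iff in L; apply omega_r_iff in R; split.
  - rewrite <- L; apply S1.
  - exact (sub_trans R (proj2 S2)).
Qed.

Lemma related_product_r (e1 e2 m : E) :
  omega_r S e1 e2 -> is_product S e1 e2 m -> related e1 m.
Proof. intros H M; left; exact (proj1 (product_right H M)). Qed.

Lemma related_product_l (e1 e2 m : E) :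
  omega_l S e1 e2 -> is_product S e2 e1 m -> related e1 m.
Proof. intros H M; right; exact (proj1 (product_left H M)). Qed.

Lemma I_Om_icc1 : icc1 (le_Om (Om := Om)) S (dist_Om (Om := Om)).
Proof.
  intros x e1 e2 f1 f2 y1 y2 [L1 _] [L2 _] O.
  apply le_Om_iff in L1, L2.
  assert (Of : omega_r S f1 f2).
  { apply omega_r_is_product, (restricts_product_iff L2 L1 L1); now apply omega_r_is_product. }
  split; [exact Of|].
  destruct (omega_r_product reg O) as (m & M & _).
  destruct (restriction_exists (product_right_below (proj1 L1) (proj1 L2) O M))
    as (n & w & W).
  assert (N : is_product S f1 f2 n) by now apply (restricts_product_iff L1 L2 W).
  destruct (dist_exists (related_product_r O M)) as [h Hh].
  destruct (dist_exists (related_product_r Of N)) as [k Hk].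
  exists m, n, w, h, k; refine (conj M (conj N (conj _ (conj Hh (conj Hk _))))).
  - split; [now apply le_Om_iff | reflexivity].
  - apply sig_eq; simpl; rewrite (proj2 Hh), (proj2 Hk); exact (restricts_leg L1 W).
Qed.

Lemma I_Om_icc1_mul : icc1 (le_Om (Om := Om)) (opposite_system S) (dist_Om (Om := Om)).
Proof.
  intros x e1 e2 f1 f2 y1 y2 [L1 _] [L2 _] O.
  apply le_Om_iff in L1, L2.
  change (omega_l S e1 e2) in O; change (omega_r (opposite_system S) f1 f2)
    with (omega_l S f1 f2).
  assert (Of : omega_l S f1 f2).
  { apply omega_l_is_product, (restricts_product_iff L1 L2 L1); now apply omega_l_is_product. }
  split; [exact Of|].
  destruct (omega_l_product reg O) as (m & M & _).
  destruct (restriction_exists (product_left_below (proj1 L1) (proj1 L2) O M))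
    as (n & w & W).
  assert (N : is_product S f2 f1 n) by now apply (restricts_product_iff L2 L1 W).
  destruct (dist_exists (related_product_l O M)) as [h Hh].
  destruct (dist_exists (related_product_l Of N)) as [k Hk].
  exists m, n, w, h, k; refine (conj M (conj N (conj _ (conj Hh (conj Hk _))))).
  - split; [now apply le_Om_iff | reflexivity].
  - apply sig_eq; simpl; rewrite (proj2 Hh), (proj2 Hk); exact (restricts_leg L1 W).
Qed.

Lemma I_Om_icc1_op : icc1 (I := opposite_category (I_Om Om))
  (opposite_le (le_Om (Om := Om))) S (opposite_dist (dist_Om (Om := Om))).
Proof.
  intros x e1 e2 f1 f2 y1 y2 [L1 _] [L2 _] O.
  apply le_Om_iff in L1, L2; unfold unop in L1, L2; simpl in L1, L2.
  assert (Of : omega_r S f1 f2).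
  { apply omega_r_is_product, (restricts_product_iff L2 L1 L1); now apply omega_r_is_product. }
  split; [exact Of|].
  destruct (omega_r_product reg O) as (m & M & _).
  destruct (corestriction_exists
    (product_right_below (proj1 (proj2 L1)) (proj1 (proj2 L2)) O M)) as (n & w & W).
  assert (N : is_product S f1 f2 n) by now apply (restricts_product_iff L1 L2 W).
  destruct (dist_exists (related_sym (related_product_r O M))) as [h Hh].
  destruct (dist_exists (related_sym (related_product_r Of N))) as [k Hk].
  exists m, n, w, h, k; refine (conj M (conj N (conj _ (conj Hh (conj Hk _))))).
  - split; [now apply le_Om_iff | reflexivity].
  - apply sig_eq; simpl; rewrite (proj2 Hh), (proj2 Hk).
    symmetry; exact (restricts_leg W L1).
Qed.

Lemma I_Om_icc1_mul_op : icc1 (I := opposite_category (I_Om Om))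
  (opposite_le (le_Om (Om := Om))) (opposite_system S)
  (opposite_dist (dist_Om (Om := Om))).
Proof.
  intros x e1 e2 f1 f2 y1 y2 [L1 _] [L2 _] O.
  apply le_Om_iff in L1, L2; unfold unop in L1, L2; simpl in L1, L2.
  change (omega_l S e1 e2) in O; change (omega_l S f1 f2 /\ exists (e12 f12 : I_Om Om)
    (y12 : @Hom (I_Om Om) f12 e12) (h : @Hom (I_Om Om) e12 e1) (k : @Hom (I_Om Om) f12 f1),
    is_product S e2 e1 e12 /\ is_product S f2 f1 f12 /\
    (le_Om (arrow y12) (unop x) /\ e12 = e12) /\ dist_Om h /\ dist_Om k /\
    y12 ;; h = k ;; y1).
  assert (Of : omega_l S f1 f2).
  { apply omega_l_is_product, (restricts_product_iff L1 L2 L1); now apply omega_l_is_product. }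
  split; [exact Of|].
  destruct (omega_l_product reg O) as (m & M & _).
  destruct (corestriction_exists
    (product_left_below (proj1 (proj2 L1)) (proj1 (proj2 L2)) O M)) as (n & w & W).
  assert (N : is_product S f2 f1 n) by now apply (restricts_product_iff L2 L1 W).
  destruct (dist_exists (related_sym (related_product_l O M))) as [h Hh].
  destruct (dist_exists (related_sym (related_product_l Of N))) as [k Hk].
  exists m, n, w, h, k; refine (conj M (conj N (conj _ (conj Hh (conj Hk _))))).
  - split; [now apply le_Om_iff | reflexivity].
  - apply sig_eq; simpl; rewrite (proj2 Hh), (proj2 Hk).
    symmetry; exact (restricts_leg W L1).
Qed.

(** Along the two sides of a singular square the composites are both the leg at
    the first vertex of the cone of the last one: for a square of left translates
    directly, for a square of right translates after the inclusion into [k]. *)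
Lemma singular_commutes (e f g h : E) : singular S e f g h ->
  G f (fstE e) ;; G h (fstE f) = G g (fstE e) ;; G h (fstE g).
Proof.
  intros [k [(He & Hf & R & P & Q)|(He & Hg & L & P & Q)]].
  - destruct (product_left He P) as (L1 & _ & _).
    destruct (product_left Hf Q) as (L2 & _ & T).
    apply L_rel_iff in L2.
    assert (B : subobj (fstE f) (fstE h)) by (rewrite L2; apply sub_refl).
    destruct B as [b B]; rewrite (leg_incl_sub B).
    rewrite leg_comp_L by apply omega_l_iff, L1.
    apply omega_l_iff in He; destruct He as [i I].
    now rewrite (T b B), (leg_incl_sub I), (leg_incl (G f) I).
  - destruct (product_right He P) as (R1 & Mf & _).
    destruct (product_right Hg Q) as (R2 & Mh & _).
    apply omega_l_iff in Mf, Mh; destruct Mf as [l J], Mh as [l' J'].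
    destruct (product_right_leg He P J) as [X1 X2].
    destruct (product_right_leg Hg Q J') as [Y1 Y2].
    assert (B : subobj (fstE f) (fstE h)).
    { apply L_rel_iff in L; rewrite X1, Y1, L; apply sub_refl. }
    rewrite (@leg_comp_L e g h) by apply omega_l_iff, L.
    destruct B as [b B]; rewrite (leg_incl_sub B).
    apply (incl_monic (cc_subobjects (con_ax C)) J').
    assert (Z : b ;; l' = l).
    { apply (incl_unique (cc_subobjects (con_ax C))); trivial.
      now apply (incl_comp (cc_subobjects (con_ax C))). }
    rewrite <- comp_assoc, Z, X2.
    apply L_rel_iff in L.
    assert (A : subobj (fstE e) (fstE g)) by (rewrite L; apply sub_refl).
    destruct A as [a A].
    now rewrite <- (leg_incl (G h) A), <- (leg_incl (G k) A), <- comp_assoc, Y2.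
Qed.

(** The distinguished morphisms in the reverse direction are the inverses. *)
Lemma singular_commutes_inverse (e f g h : E) : singular S e f g h ->
  related e f -> related f h -> related e g -> related g h ->
  G f (fstE h) ;; G e (fstE f) = G g (fstE h) ;; G e (fstE g).
Proof.
  intros H R1 R2 R3 R4; pose proof (singular_commutes H) as X.
  assert (U : forall x : E, related e x -> related x h ->
    G x (fstE h) ;; G e (fstE x) ;; (G x (fstE e) ;; G h (fstE x)) = idm _).
  { intros x H1 H2.
    rewrite <- comp_assoc, (comp_assoc (G e (fstE x))).
    rewrite (related_inverse (related_sym H1)), comp_id_l.
    exact (related_inverse (related_sym H2)). }
  apply (proj1 (bimorphism_comp (related_bimorphism R1) (related_bimorphism R2))).
  rewrite (U f R1 R2), X; now rewrite U.
Qed.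

Lemma I_Om_inductive : inductive_cancellative_category (le_Om (Om := Om)) S
  (dist_Om (Om := Om)).
Proof.
  split.
  - apply I_Om_ordered.
  - exact reg.
  - intros e f; rewrite le_Om_iff, restricts_id; apply omega_iff.
  - apply I_Om_distinguished.
  - apply I_Om_icc1.
  - apply I_Om_icc1_mul.
  - apply I_Om_icc1_op.
  - apply I_Om_icc1_mul_op.
  - intros e f g h ef fh eg gh H [_ H1] [_ H2] [_ H3] [_ H4].
    apply sig_eq; simpl; rewrite H1, H2, H3, H4; now apply singular_commutes.
  - intros e f g h ef fh eg gh H [_ H1] [_ H2] [_ H3] [_ H4].
    apply singular_transpose in H.
    apply sig_eq; simpl; rewrite H1, H2, H3, H4; symmetry; now apply singular_commutes.
  - intros e f g h ef fh eg gh H [R1 H1] [R2 H2] [R3 H3] [R4 H4].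
    apply sig_eq; simpl; rewrite H1, H2, H3, H4.
    apply singular_commutes_inverse; trivial; now apply related_sym.
  - intros e f g h ef fh eg gh H [R1 H1] [R2 H2] [R3 H3] [R4 H4].
    apply singular_transpose in H.
    apply sig_eq; simpl; rewrite H1, H2, H3, H4; symmetry.
    apply singular_commutes_inverse; trivial; now apply related_sym.
Qed.

End Regular.
End Semigroup.

Theorem theorem7p2 (C D : ConsistentCategory) (Om : CrossConnection C D)
  (E_Om_regular : regular_biordered_set (S_Om Om)) :
  inductive_cancellative_category (le_Om (Om := Om)) (S_Om Om)
    (dist_Om (Om := Om)) /\
  (forall (u : Arrow (I_Om Om)) (e : I_Om Om) (w : Arrow (I_Om Om)),
     subE e (src u) ->
     (is_restriction (le_Om (Om := Om)) u e w <-> restriction_Om u e w)) /\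
  (forall (u : Arrow (I_Om Om)) (f : I_Om Om) (w : Arrow (I_Om Om)),
     subE f (tgt u) ->
     (is_corestriction (le_Om (Om := Om)) u f w <-> corestriction_Om u f w)).
Proof.
  split; [exact (I_Om_inductive E_Om_regular) | split].
  - intros u e w _; split.
    + intros [(H1 & H2 & H3) <-]; exact (conj eq_refl (conj H1 (conj H2 H3))).
    + intros (<- & H1 & H2 & H3); exact (conj (conj H1 (conj H2 H3)) eq_refl).
  - intros u f w _; split.
    + intros [(H1 & H2 & v & V & H3) <-]; exact (conj eq_refl (conj H1 (conj H2
        (ex_intro _ v (conj V (eq_sym H3)))))).
    + intros (<- & H1 & H2 & v & V & H3); exact (conj (conj H1 (conj H2
        (ex_intro _ v (conj V (eq_sym H3))))) eq_refl).
Qed.
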